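(* Let $(X,d)$ be a complete metric space equipped with a $\delta$-Ahlfors regular measure $\mu$, with constants $a_\mu,b_\mu$. Let $\mathcal{P}$ be a collection of closed subsets of $X$ and suppose that $\mu$ is absolutely $(\eta,\mathcal{P})$-decaying with constant $C_{dec}$. Let $r_0>0$ be such that both of these properties hold at scales below $r_0$. Let $(N_i,R_i)_{i\in\mathbb{N}}$ be a sequence in $\mathbb{N}^2$ with $N_i$ strictly increasing. Suppose $S\subset X$ is $(N_{i},R_{i})$-rapid $(\beta,\rho,\mathcal{P})$-absolutely winning for some $$0<\beta<\left(C_{dec}^{-1}\tfrac{a_{\mu}^{2}}{b_{\mu}^{2}}2^{-2\delta-\eta-2}\right)^{1/\eta}$$ and some $\rho$ with $r_{0}>\rho>0$. Then, for every ball $B\subset X$ with radius $r(B)$ satisfying $r_{0}>r(B)\geq \rho$, we have $$\dim_{H} (S\cap B) \geq \liminf_{n\to\infty} \left(1-\frac{\sum_{i=1}^{n}R_{i}}{N_{n}+1+\sum_{i=1}^{n}(R_{i}-1)}\right)\left(\delta-\frac{\log (c_{1}-c_{2}\beta^{\eta})}{\log \beta }\right),$$ $$\dim_{P} (S\cap B) \geq \limsup_{n\to \infty} \left(1- \frac{\sum_{i=1}^{n-1}R_{i}}{N_{n}+\sum_{i=1}^{n-1}(R_{i}-1)} \right)\left(\delta-\frac{\log (c_{1}-c_{2}\beta^{\eta})}{\log \beta } \right),$$ where $c_{1}=\tfrac{1}{2}\frac{a_{\mu}}{b_{\mu}}\left(\frac{1}{4}\right)^{\delta}$ and $c_{2}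=C_{dec}\frac{b_{\mu}}{a_{\mu}}2^{\eta+1}$.
   Context: $\dim_H$ and $\dim_P$ denote Hausdorff and packing dimension. $B(x,r)$ is the ball of centre $x\in X$ and radius $r$; balls are considered together with their centre and radius. For $P\subset X$ and $r>0$, $\Delta(P,r):=\{x\in X: \inf_{s\in P} d(s,x)\le r\}$. Ahlfors $\delta$-regular: for $r_0>0$ sufficiently small there exist constants $0<a_\mu\le 1\le b_\mu<\infty$ such that $a_\mu r^\delta\le \mu(B(x,r))\le b_\mu r^\delta$ for all $0<r\le r_0$ and all $x\in X$. Absolutely $(\eta,\mathcal{P})$-decaying (with constants $\eta,C_{dec},r_0>0$): for every ball $B(x,r)$ with $x\in X$ and $0<r<r_0$, every $P\in\mathcal{P}$ and every $\varepsilon>0$, $\mu(B(x,r)\cap\Delta(P,\varepsilon r))\le C_{dec}\,\varepsilon^\eta\mu(B(x,r))$. The $(N_i,R_i)$-rapid $(\beta,\rho,\mathcal{P})$-absolute game: let $\beta,\rho>0$, $\mathcal{P}$ a collection of subsets of $X$, and $(N_i,R_i)_{i\in\mathbb{N}}$ a sequence of pairs of positive integers with $N_i$ strictly increasing. Two players, Alice and Bob, play as follows. Bob starts by playing any ball $B_0=B(x_0,\rho_0)$ with $\rho_0\ge\rho$. Suppose Bob's ball $B_n=B(x_n,\rho_n)$ has been played ($n\ge 0$). - If $n\notin\{N_i: i\in\mathbb{N}\}$, Alice responds by choosing some $P_n\in\mathcal{P}$ and removing $A_n=\Delta(P_n,\beta\rho_n)$; Bob must then play a ball $B_{n+1}=B(x_{n+1},\rho_{n+1})$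 with $B_{n+1}\subseteq B_n\setminus A_n$ and $\rho_{n+1}=\beta\rho_n$. - If $n=N_j$ for some $j$, Alice responds by choosing any ball $A_n=B(x_{n+1},\beta^{R_j}\rho_n)\subset B_n$, and this automatically becomes Bob's next ball: $B_{n+1}=A_n$. The game continues indefinitely. If at some point Bob cannot play a legal ball, Alice wins by default. Otherwise the balls $B_n$ are nested with decreasing radii and the outcome is their limit point $x_\infty$ (the limit of the centres $x_n$). A set $S\subset X$ is $(N_i,R_i)$-rapid $(\beta,\rho,\mathcal{P})$-absolutely winning if Alice has a strategy guaranteeing that $x_\infty\in S$ (or that she wins by default). *)

(* Defs.v *)
From HB Require Import structures.
From mathcomp Require Import all_boot all_order all_algebra.
From mathcomp Require Import all_classical all_reals all_analysis.

Set Implicit Arguments.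
Unset Strict Implicit.
Unset Printing Implicit Defensive.

Import Order.TTheory GRing.Theory Num.Theory.
Import numFieldNormedType.Exports.

Local Open Scope classical_set_scope.
Local Open Scope ring_scope.

(* The library has metric spaces and complete pseudometric spaces, but not
   their join.  Its complete spaces are pointed, hence nonempty. *)
#[short(type="completeMetricType")]
HB.structure Definition CompleteMetric (R : numDomainType) :=
  {X of CompletePseudoMetric R X & PseudoMetric_isMetric R X}.

(* Measures are Borel measures: their domain is the sigma-algebra generated by
   the open sets. *)
Definition borelType (X : ptopologicalType) := g_sigma_algebraType (@open X).

Section metric.
Context {R : realType} {X : metricType R}.
Implicit Types (A P U : set X) (x y : X) (s e r : R).

(* The library's [ball x r] is open, and its [closed_ball x r] is the closure
   of [ball x r], which may be smaller than the set below. *)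
Definition cball x r : set X := [set y | mdist x y <= r].

(* The infimum is taken in \bar R, so that [nbhood set0 r = set0]. *)
Definition nbhood P r : set X :=
  [set x | (ereal_inf [set (mdist s x)%:E | s in P] <= r%:E)%E].

(* The added 0 only matters for the empty set, whose diameter is thus 0. *)
Definition diam U : \bar R :=
  ereal_sup (0%E |` [set (mdist p.1 p.2)%:E | p in U `*` U]).

Definition hausdorff_content s e A : \bar R :=
  ereal_inf [set (\sum_(0 <= i <oo) diam (U i) `^ s)%E |
    U in [set U : nat -> set X |
      A `<=` \bigcup_i U i /\ forall i, (diam (U i) <= e%:E)%E]].

Definition hausdorff_measure s A : \bar R :=
  ereal_sup [set hausdorff_content s e A | e in [set e | 0 < e]].

(* In this and in [packing_dim] the exponent s = 0 is left out: this does not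
   change the infimum and avoids a convention for 0 `^ 0. *)
Definition hausdorff_dim A : \bar R :=
  ereal_inf [set s%:E | s in [set s | 0 < s /\ hausdorff_measure s A = 0%E]].

(* The supremum over countable packings is attained along finite ones.
   Diameters of balls are replaced by 2r, as usual in a metric space, where a
   ball does not determine its radius. *)
Definition packing_content s e A : \bar R :=
  ereal_sup [set v | exists n (x : 'I_n -> X) (r : 'I_n -> R),
    [/\ forall i, A (x i),
        forall i, 0 < r i <= e,
        trivIset setT (fun i => cball (x i) (r i)) &
        v = (\sum_(i < n) (2 * r i) `^ s)%:E]].

Definition packing_premeasure s A : \bar R :=
  ereal_inf [set packing_content s e A | e in [set e | 0 < e]].

Definition packing_measure s A : \bar R :=
  ereal_inf [set (\sum_(0 <= i <oo) packing_premeasure s (F i))%E |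
    F in [set F : nat -> set X | A `<=` \bigcup_i F i]].

Definition packing_dim A : \bar R :=
  ereal_inf [set s%:E | s in [set s | 0 < s /\ packing_measure s A = 0%E]].

(* [mu] is only required to be a set function so that these predicates can be
   stated before fixing a sigma-algebra. *)
Definition ahlfors_regular (mu : set X -> \bar R) (delta a b r0 : R) : Prop :=
  [/\ 0 < a <= 1, 1 <= b &
      forall x r, 0 < r <= r0 ->
        ((a * r `^ delta)%:E <= mu (cball x r) <= (b * r `^ delta)%:E)%E].

Definition absolutely_decaying (mu : set X -> \bar R) (PP : set (set X))
    (eta C r0 : R) : Prop :=
  [/\ 0 < eta, 0 < C &
      forall x r, 0 < r < r0 -> forall P, PP P -> forall e, 0 < e ->
        (mu (cball x r `&` nbhood P (e * r)) <=
           (C * e `^ eta)%:E * mu (cball x r))%E].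

End metric.

Section game.
Context {R : realType} {X : metricType R}.

Record gball := GBall { centre : X ; radius : R }.

Definition gset (B : gball) : set X := cball (centre B) (radius B).

(* A strategy of Alice maps the sequence [:: B_0; ...; B_n] of Bob's balls to
   her n-th move: the set P_n on an ordinary turn, the centre of her ball A_n
   on a rapid turn (the radius is imposed by the rules).  Her own earlier moves
   are determined by the strategy. *)
Record strategy := Strategy {
  removed_set : seq gball -> set X ;
  chosen_centre : seq gball -> X }.

Variables (N Rr : nat -> nat) (beta rho : R) (PP : set (set X)).
Variable (sigma : strategy).
Implicit Type B : nat -> gball.

Definition history B n : seq gball := mkseq B n.+1.

Definition alice_ball B n j : gball :=
  GBall (chosen_centre sigma (history B n)) (beta ^+ Rr j * radius (B n)).

(* Turn n is legal for Bob, Alice following [sigma]. *)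
Definition bob_turn B n : Prop :=
  (forall j, n = N j -> B n.+1 = alice_ball B n j) /\
  ((forall j, n <> N j) ->
    radius (B n.+1) = beta * radius (B n) /\
    gset (B n.+1) `<=` gset (B n) `\`
      nbhood (removed_set sigma (history B n)) (beta * radius (B n))).

(* Alice's move at turn n is legal. *)
Definition alice_turn B n : Prop :=
  (forall j, n = N j -> gset (alice_ball B n j) `<=` gset (B n)) /\
  ((forall j, n <> N j) -> PP (removed_set sigma (history B n))).

(* [:: B 0; ...; B n] is a position reached when Alice follows [sigma]. *)
Definition reached B n : Prop :=
  rho <= radius (B 0%N) /\ forall k, (k < n)%N -> bob_turn B k.

Definition legal_strategy : Prop :=
  forall B n, reached B n -> alice_turn B n.

(* Plays in which Bob gets stuck are won by Alice by default, so that only the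
   infinite plays have to be considered. *)
Definition winning_strategy (S : set X) : Prop :=
  legal_strategy /\
  forall B, (forall n, reached B n) ->
    exists2 x, centre (B n) @[n --> \oo] --> x & S x.

End game.

Arguments gball {R} X.
Arguments strategy {R} X.

(* The pairs (N_i, R_i) are indexed from i = 0. *)
Definition rapid_absolutely_winning {R : realType} {X : metricType R}
    (N Rr : nat -> nat) (beta rho : R) (PP : set (set X)) (S : set X) : Prop :=
  exists sigma : strategy X, winning_strategy N Rr beta rho PP sigma S.

(* Main.v *)
Require Import Defs.
From HB Require Import structures.
From mathcomp Require Import all_boot all_order all_algebra.
From mathcomp Require Import all_classical all_reals all_analysis.
From mathcomp Require Import ring lra.

(* While Alice follows her winning strategy, on each ordinary turn the decay
   condition and Ahlfors regularity leave Bob at least beta^(-D) pairwise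
   disjoint legal balls; on a rapid turn there is a single one.  His choices are
   coded by words, and all the balls coded by words of length n have the same
   radius r * beta^(depth n), so S contains the limit set of a tree of balls in
   which everything depends only on the level.

   Hausdorff dimension: a set of diameter comparable to the radius of level n
   meets boundedly many cells of that level.  If the sum of diam^s over a cover
   were small, the expected number of sets of the cover met by a random branch
   would be less than 1; choosing at each step a child that does not increase
   this expectation produces a branch that avoids the whole cover.

   Packing dimension: if F meets every cell below some word, then
   well-separated points of F in the cells of a deep level form a packing whose
   s-content is large.  Hence a set of small packing premeasure misses some cell
   below any given word, and a countable cover by such sets is avoided by a
   branch obtained by successive extensions. *)

Set Implicit Arguments.
Unset Strict Implicit.
Unset Printing Implicit Defensive.

Import Order.TTheory GRing.Theory Num.Theory.
Import numFieldNormedType.Exports.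

Local Open Scope classical_set_scope.
Local Open Scope ring_scope.

(** * Balls in an Ahlfors regular space *)

Section metric_balls.
Context {R : realType} {X : metricType R}.
Implicit Types (P E : set X) (x y z : X) (r s t : R).

Lemma cball_center x r : 0 <= r -> cball x r x.
Proof. by rewrite /cball /= mdistxx. Qed.

Lemma cball_sym x y r : cball x r y -> cball y r x.
Proof. by rewrite /cball /= metric_sym. Qed.

Lemma cball_trans y x z r s : cball x r y -> cball y s z -> cball x (r + s) z.
Proof.
by rewrite /cball /= => xy yz; apply: le_trans (metric_triangle _ y _) (lerD xy yz).
Qed.

Lemma cball_sub y x r s t :
  cball x r y -> r + s <= t -> cball y s `<=` cball x t.
Proof.
move=> xy rst z yz; rewrite /cball /=.
by apply: le_trans rst; apply: (cball_trans xy).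
Qed.

Lemma disjoint_cball x y r :
  2 * r < mdist x y -> cball x r `&` cball y r = set0.
Proof.
move=> xy; apply/seteqP; split => // z [xz /cball_sym yz]; move: xy.
rewrite ltNge => /negP; apply.
by have := cball_trans xz yz; rewrite /cball /= mulr2n mulrDl mul1r.
Qed.

Lemma closed_cball x r : closed (cball x r).
Proof.
move=> y yc; rewrite /cball /=; apply/ler_addgt0Pr => e e0.
have [z [xz]] := yc _ (nbhsx_ballx y e e0).
rewrite ballEmdist /= metric_sym => /ltW zy.
exact: (cball_trans xz).
Qed.

Lemma nbhood_cball P r t x y : nbhood P r y -> cball x t y -> nbhood P (r + t) x.
Proof.
move=> /= Py xy; apply/lee_addgt0Pr => e e0.
have : (ereal_inf [set (mdist s y)%:E | s in P] < (r + e)%:E)%E.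
  by apply: le_lt_trans Py _; rewrite lte_fin ltrDl.
move=> /ereal_inf_lt[_ [s Ps <-]]; rewrite lte_fin => sy.
apply: ge_ereal_inf; exists (mdist s x)%:E; first by exists s.
rewrite -EFinD lee_fin addrAC.
by apply: (cball_trans (ltW sy)); exact: cball_sym.
Qed.

Lemma closed_nbhood P r : closed (nbhood P r).
Proof.
move=> y yc; rewrite /nbhood /=; apply/lee_addgt0Pr => e e0.
have [z [Pz]] := yc _ (nbhsx_ballx y e e0).
by rewrite ballEmdist /= => /ltW yz; have := nbhood_cball Pz yz.
Qed.

(** The set is grown one point at a time. In applications the hypothesis is checked by
    contradiction: if no [z] can be added, then [E] is covered by fewer than [m] balls of radius
    [t], which a measure or counting estimate rules out. *)
Lemma greedy_separated E t m :
  (forall s : seq X, (size s < m)%N -> (forall y, y \in s -> E y) ->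
     exists2 z, E z & forall y, y \in s -> t < mdist z y) ->
  exists s : seq X, [/\ size s = m, forall y, y \in s -> E y &
    pairwise (fun y z => t < mdist y z) s].
Proof.
move=> next.
suff : forall k, (k <= m)%N -> exists s : seq X, [/\ size s = k,
    forall y, y \in s -> E y & pairwise (fun y z => t < mdist y z) s].
  by move=> /(_ m (leqnn m)).
elim=> [|k IHk] km; first by exists [::].
have [s [sk sE ps]] := IHk (ltnW km).
have [||z Ez zs] := next s; rewrite ?sk//.
exists (z :: s) => /=; split; first by rewrite sk.
  by move=> y; rewrite inE => /orP[/eqP ->//|]; exact: sE.
by rewrite ps andbT; apply/allP => y /zs.
Qed.

End metric_balls.

Section ahlfors.
Context {R : realType} {X : completeMetricType R}.
Variables (mu : {measure set (borelType X) -> \bar R}) (delta a b r0 : R).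
Hypothesis hmu : ahlfors_regular mu delta a b r0.
Hypothesis hr0 : 0 < r0.

Lemma borel_closed (F : set X) :
  closed F -> measurable (F : set (borelType X)).
Proof.
move=> cF; rewrite -[F]setCK; apply: measurableC.
by apply: sub_sigma_algebra; exact: closed_openC.
Qed.

Lemma ahlfors_ge x r : 0 < r <= r0 -> ((a * r `^ delta)%:E <= mu (cball x r))%E.
Proof. by case: hmu => _ _ h /(h x)/andP[]. Qed.

Lemma ahlfors_le x r : 0 < r <= r0 -> (mu (cball x r) <= (b * r `^ delta)%:E)%E.
Proof. by case: hmu => _ _ h /(h x)/andP[]. Qed.

(** With a negative exponent the lower bound on small balls would tend to infinity as the radius
    shrinks, while these balls stay inside one ball of finite measure. *)
Lemma ahlfors_exponent_ge0 : 0 <= delta.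
Proof.
have [/andP[a0 a1] b1 _] := hmu; rewrite leNgt; apply/negP => d0.
have b0 : 0 < b by apply: lt_le_trans b1.
pose M := b * r0 `^ delta; have M0 : 0 < M by rewrite mulr_gt0 ?powR_gt0.
(* This radius satisfies [r ^ delta >= M / a + 1], so the lower bound is at least [M + a], above the
   measure [M] available. *)
pose r := Num.min r0 ((M / a + 1) `^ delta^-1).
have Ma : 0 < M / a + 1 by rewrite addr_gt0 ?divr_gt0.
have rr : 0 < r <= r0.
  by rewrite /r lt_min hr0 powR_gt0//= ge_min lexx.
have : ((a * r `^ delta)%:E <= (b * r0 `^ delta)%:E)%E.
  apply: le_trans (ahlfors_ge point rr) _.
  apply: le_trans (ahlfors_le point _); last by rewrite hr0 lexx.
  apply: le_measure; rewrite ?inE; try (by apply: borel_closed; exact: closed_cball).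
  apply: (@cball_sub _ _ point _ 0); first exact: cball_center.
  by rewrite add0r; case/andP: rr.
rewrite lee_fin leNgt => /negP; apply.
have: (M / a + 1) <= r `^ delta.
  have [r_gt0 _] := andP rr.
  have rle : r <= (M / a + 1) `^ delta^-1 by rewrite /r ge_min lexx orbT.
  have -> : M / a + 1 = ((M / a + 1) `^ delta^-1) `^ delta.
    by rewrite -powRrM mulVf ?lt_eqF// powRr1// ltW.
  set y := _ `^ delta^-1 in rle *; have y0 : 0 < y by rewrite powR_gt0.
  rewrite -(opprK delta) !(powRN _ (- delta)).
  rewrite lef_pV2 ?posrE ?powR_gt0//.
  by apply: ge0_ler_powR; rewrite ?nnegrE ?oppr_ge0// ltW.
rewrite -(ler_pM2l a0) mulrDr mulrCA divff ?gt_eqF// !mulr1.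
by apply: lt_le_trans; rewrite ltrDl.
Qed.

(** Additivity of [mu] on disjoint balls, compared with the upper bound for the ball containing
    them. The balls are indexed by [T] so that the index can be a word. *)
Lemma ahlfors_packing (T : choiceType) (s : seq T) (c : T -> X) y r t :
  uniq s -> 0 < r <= r0 -> 0 < t <= r0 ->
  (forall u v, u \in s -> v \in s -> u != v ->
     cball (c u) r `&` cball (c v) r = set0) ->
  (forall u, u \in s -> cball (c u) r `<=` cball y t) ->
  (size s)%:R * (a * r `^ delta) <= b * t `^ delta.
Proof.
move=> us rr tt dis sub.
pose F u : set (borelType X) := cball (c u) r.
have mF u : measurable (F u) by by apply: borel_closed; exact: closed_cball.
have cup s' : measurable (\big[setU/set0]_(u <- s') F u).
  by apply: bigsetU_measurable.
have : (((size s)%:R * (a * r `^ delta))%:E <= mu (\big[setU/set0]_(u <- s) F u))%E.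
  elim: s us dis {sub} => [|u s IHs] /=.
    by rewrite mul0r big_nil measure0.
  move=> /andP[us uniqs] dis; rewrite big_cons measureU //; last first.
    rewrite -subset0 => z [uz]; rewrite -bigcup_seq => -[v /= vs vz].
    have := dis u v; rewrite !inE eqxx vs orbT => /(_ isT isT).
    have uv : u != v by apply: contraNneq us => ->.
    by move=> /(_ uv) uv0; have : (set0 : set X) z by rewrite -uv0.
  rewrite -addn1 addnC natrD mulrDl mul1r EFinD leeD//.
    exact: ahlfors_ge.
  apply: IHs => // v w vs ws; apply: dis; by rewrite inE ?vs ?ws orbT.
move=> /le_trans h; rewrite -lee_fin; apply: h.
apply: le_trans (ahlfors_le y tt); apply: le_measure; rewrite ?inE//.
  by apply: borel_closed; exact: closed_cball.
by rewrite -bigcup_seq => z [u su]; apply: sub.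
Qed.

Lemma ahlfors_cover (s : seq X) t : 0 < t <= r0 ->
  (mu (\big[setU/set0]_(y <- s) (cball y t : set (borelType X))) <=
     ((size s)%:R * (b * t `^ delta))%:E)%E.
Proof.
move=> tt; elim: s => [|y s IHs]; first by rewrite big_nil measure0 mul0r.
have mF u : measurable (cball u t : set (borelType X)).
  by apply: borel_closed; exact: closed_cball.
rewrite big_cons; apply: le_trans.
  by apply: measureU2 => //; apply: bigsetU_measurable.
by rewrite /= -addn1 addnC natrD mulrDl mul1r EFinD leeD// ahlfors_le.
Qed.

(** This supplies Bob's legal moves on an ordinary turn. If a separated set of fewer than [m]
    centres could not be extended, the doubled balls together with the neighbourhood of [P] would
    cover half of the ball [cball x r] in radius, and their total measure is too small for that. *)
Lemma separated_children (PP : set (set X)) (eta C beta : R) (m : nat) (P : set X) x r :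
  absolutely_decaying mu PP eta C r0 -> PP P -> 0 < r < r0 ->
  0 < beta -> 4 * beta <= 1 ->
  m%:R <= beta `^ (- delta) * (2^-1 * (a / b) * (4^-1) `^ delta
            - C * (b / a) * 2 `^ (eta + 1) * beta `^ eta) + 1 ->
  exists s : seq X, [/\ size s = m,
    forall y, y \in s ->
      cball y (beta * r) `<=` cball x r `\` nbhood P (beta * r) &
    pairwise (fun y z => 2 * (beta * r) < mdist y z) s].
Proof.
move=> [eta0 C0 dec] PPP /andP[r_gt0 rr0] beta0 beta4 mle.
have [/andP[a0 a1] b1 _] := hmu; have b0 : 0 < b by apply: lt_le_trans b1.
have delta0 := ahlfors_exponent_ge0.
(* A ball of radius [beta * r] centred in [E] stays inside [cball x r], and it misses the
   [beta * r]-neighbourhood of [P]: otherwise its centre would be within [2 * beta * r] of [P]. *)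
pose E := cball x ((1 - beta) * r) `\` nbhood P (2 * beta * r).
have [|s [sm sE ps]] := @greedy_separated _ _ E (2 * beta * r) m.
  move=> s sm sE; apply: contrapT => nz.
  have mc u t : measurable (cball u t : set (borelType X)).
    by apply: borel_closed; exact: closed_cball.
  have mn t : measurable (nbhood P t : set (borelType X)).
    by apply: borel_closed; exact: closed_nbhood.
  have cov : cball x ((1 - beta) * r) `<=`
      (cball x r `&` nbhood P (2 * beta * r)) `|`
      \big[setU/set0]_(y <- s) (cball y (2 * beta * r)).
    move=> z xz; have [Pz|nPz] := pselect (nbhood P (2 * beta * r) z).
      left; split => //; apply: le_trans xz _.
      by rewrite ler_piMl ?(ltW r_gt0)// gerBl ltW.
    right; apply: contrapT => nsz; apply: nz; exists z; first by [].
    move=> y ys; rewrite ltNge; apply/negP => yz; apply: nsz.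
    by rewrite -bigcup_seq; exists y => //; exact: cball_sym.
  have : (mu (cball x ((1 - beta) * r)) <=
      (C * (2 * beta) `^ eta)%:E * mu (cball x r) +
      ((size s)%:R * (b * (2 * beta * r) `^ delta))%:E)%E.
    apply: (@le_trans _ _ (mu ((cball x r `&` nbhood P (2 * beta * r)) `|`
      \big[setU/set0]_(y <- s) (cball y (2 * beta * r) : set (borelType X))))).
      apply: le_measure; rewrite ?inE//.
      apply: measurableU; first exact: measurableI.
      by apply: bigsetU_measurable.
    apply: le_trans.
      apply: measureU2; first exact: measurableI.
      by apply: bigsetU_measurable.
    apply: leeD.
      by apply: dec; rewrite ?r_gt0// mulr_gt0.
    apply: ahlfors_cover; rewrite !mulr_gt0//=; nra.
  apply/negP; rewrite -ltNge.
  have C2 : 0 <= C * (2 * beta) `^ eta by rewrite mulr_ge0 ?powR_ge0 ?ltW.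
  apply: (@le_lt_trans _ _ ((C * (2 * beta) `^ eta) * (b * r `^ delta) +
      (size s)%:R * (b * (2 * beta * r) `^ delta))%:E).
    rewrite EFinD leeD2r// (EFinM (C * _)) lee_wpmul2l ?lee_fin//.
    by apply: ahlfors_le; rewrite r_gt0 ltW.
  apply: lt_le_trans (ahlfors_ge _ _); last by apply/andP; split; nra.
  rewrite lte_fin.
  (* This is where [1 / 4] appears in the constants: one factor 2 comes from halving [r], the other
     from balls of radius [2 * beta * r]. *)
  have half : 2^-1 * r <= (1 - beta) * r by nra.
  apply: (@lt_le_trans _ _ (a * (2^-1 * r) `^ delta)); last first.
    rewrite ler_pM2l//; apply: ge0_ler_powR; rewrite ?nnegrE//; nra.
  (* The summand 1 in the bound on [m] is absorbed by [size s < m]. *)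
  have kle : (size s)%:R <= beta `^ (- delta) * (2^-1 * (a / b) * (4^-1) `^ delta
            - C * (b / a) * 2 `^ (eta + 1) * beta `^ eta).
    rewrite -(lerD2r 1); apply: le_trans mle; rewrite -[1]/(1%:R) -natrD ler_nat.
    by rewrite addn1.
  move: kle; have -> : (4^-1 : R) = 2^-1 * 2^-1 by rewrite -invfM; congr (_^-1); ring.
  rewrite powRD ?pnatr_eq0 ?implybT// powRr1//.
  rewrite !powRM ?invr_ge0 ?mulr_ge0 ?(ltW beta0) ?(ltW r_gt0)//.
  have -> : (2^-1 : R) `^ delta = (2 `^ delta)^-1.
    by rewrite -[2^-1]powR_inv1// -powRrM mulN1r powRN.
  rewrite powRN.
  have Y0 : 0 < r `^ delta by rewrite powR_gt0.
  have B0 : 0 < beta `^ delta by rewrite powR_gt0.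
  have H0 : 0 < beta `^ eta by rewrite powR_gt0.
  have W0 : 0 < 2 `^ eta :> R by rewrite powR_gt0.
  have T1 : 1 <= 2 `^ delta :> R.
    by have := @ler_powR R 2 _ 0 delta delta0; rewrite powRr0; apply; rewrite ler1n.
  (* With the powers turned into positive variables, the rest is algebra. The term [C * W * H * b]
     of the removed neighbourhood is dominated, by [bT], by what [kle'] subtracts, and the other
     half of [a / T] gives strictness. *)
  move: (r `^ delta) (beta `^ delta) (beta `^ eta) (2 `^ eta) (2 `^ delta) Y0 B0 H0 W0 T1.
  move=> Y B H W T Y0 B0 H0 W0 T1.
  have T0 : 0 < T by apply: lt_le_trans T1.
  move: (size s)%:R => k kle.
  have kle' : k * (b * T * B) <=
      2^-1 * (a / T) - 2 * (C * W * H * (b ^+ 2 / a * T)).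
    apply: le_trans (ler_wpM2r _ kle) _; first by rewrite !mulr_ge0 ?ltW.
    by rewrite le_eqVlt; apply/orP; left; apply/eqP; field; rewrite !gt_eqF.
  have bT : C * W * H * b <= C * W * H * (b ^+ 2 / a * T).
    rewrite ler_pM2l ?mulr_gt0//.
    have -> : b ^+ 2 / a * T = b * (b / a * T) by ring.
    rewrite -[leLHS]mulr1 ler_pM2l// -[leLHS]mulr1 ler_pM// ler_pdivlMr// mul1r.
    exact: le_trans a1 b1.
  have CWHb : 0 < C * W * H * b by rewrite !mulr_gt0.
  have aT : 0 < a / T by rewrite divr_gt0.
  have -> : C * (W * H) * (b * Y) + k * (b * (T * B * Y)) =
      (C * W * H * b + k * (b * T * B)) * Y by ring.
  by rewrite mulrA ltr_pM2r//; lra.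
exists s; split => // [y /sE [xy nPy]|]; last first.
  by apply: sub_pairwise ps => y z; rewrite mulrA.
move=> z yz; split.
  by apply: (cball_sub xy) yz; rewrite mulrBl mul1r subrK.
move=> Pz; apply: nPy; have := nbhood_cball Pz yz.
by congr (nbhood P _ y); ring.
Qed.

End ahlfors.

(** * Words *)

Section words.
Variable b : nat -> nat.
Hypothesis b_gt0 : forall n, (0 < b n)%N.
Implicit Types (v w : seq nat) (f : nat -> nat).

Definition word_ok w := all (fun i => (nth 0%N w i < b i)%N) (iota 0 (size w)).

Lemma word_ok_rcons w k :
  word_ok (rcons w k) = word_ok w && (k < b (size w))%N.
Proof.
rewrite /word_ok size_rcons -addn1 iotaD all_cat /= andbT.
rewrite nth_rcons ltnn eqxx; congr (_ && _).
apply: eq_in_all => i; rewrite mem_iota add0n => /= iw.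
by rewrite nth_rcons iw.
Qed.

Lemma word_ok_nth w i : word_ok w -> (nth 0%N w i < b i)%N.
Proof.
move=> /allP wok; have [iw|wi] := ltnP i (size w); last by rewrite nth_default.
by apply: wok; rewrite mem_iota.
Qed.

Fixpoint ext v k : seq (seq nat) :=
  if k is k'.+1 then
    [seq rcons w i | w <- ext v k', i <- iota 0 (b (size v + k'))]
  else [:: v].

Definition width n := (\prod_(i < n) b i)%N.

Lemma width_gt0 n : (0 < width n)%N.
Proof. by apply: prodn_gt0. Qed.

(** Every word of length [size v] has the same number of descendants at a given level; the product
    form avoids a division. *)
Lemma size_ext v k : (size (ext v k) * width (size v))%N = width (size v + k).
Proof.
elim: k => [|k IHk] /=; first by rewrite mul1n addn0.
by rewrite size_allpairs size_iota mulnAC IHk addnS /width big_ord_recr.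
Qed.

Lemma ext_uniq v k : uniq (ext v k).
Proof.
elim: k => //= k IHk; apply: allpairs_uniq => //; first exact: iota_uniq.
by move=> [w i] [w' i'] _ _ /= /rcons_inj[-> ->].
Qed.

Lemma mem_ext v k w : word_ok v -> w \in ext v k ->
  [/\ size w = (size v + k)%N, word_ok w & prefix v w].
Proof.
move=> vok; elim: k w => [|k IHk] w /=.
  by rewrite inE => /eqP ->; rewrite addn0 prefix_refl.
move=> /allpairsP[[u i] /= [/IHk[su uok vu]]].
rewrite mem_iota add0n => /= ib ->; split.
- by rewrite size_rcons su addnS.
- by rewrite word_ok_rcons uok su.
- by rewrite -cats1; apply: prefix_trans vu _; exact: prefix_prefix.
Qed.

(** [ext] adds letters at the far end, whereas choosing a child of [v] fixes the first new letter;
    this regroups the descendants accordingly. *)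
Lemma sum_ext_child v k (F : seq nat -> nat) :
  (\sum_(w <- ext v k.+1) F w =
   \sum_(i <- iota 0 (b (size v))) \sum_(w <- ext (rcons v i) k) F w)%N.
Proof.
elim: k F => [|k IHk] F.
  rewrite big_allpairs_dep /= big_seq1 addn0; apply: eq_bigr => i _.
  by rewrite big_seq1.
rewrite [ext v k.+2]/= big_allpairs_dep IHk; apply: eq_bigr => i _.
by rewrite [ext _ k.+1]/= big_allpairs_dep size_rcons addSnnS.
Qed.

Lemma branch_of_step (P : seq nat -> Prop) : P [::] ->
  (forall v, word_ok v -> P v -> exists2 k, (k < b (size v))%N & P (rcons v k)) ->
  exists2 f, (forall n, (f n < b n)%N) & forall n, P (mkseq f n).
Proof.
move=> P0 step.
have /choice[g gP] : forall v, exists k, word_ok v -> P v ->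
    (k < b (size v))%N /\ P (rcons v k).
  move=> v.
  have [[vok Pv]|nvP] := pselect (word_ok v /\ P v).
    by have [k kb Pk] := step v vok Pv; exists k.
  by exists 0%N => vok Pv; case: nvP.
pose W := fix W n := if n is n'.+1 then rcons (W n') (g (W n')) else [::].
have WP n : [/\ size (W n) = n, word_ok (W n) & P (W n)].
  elim: n => [//|n [sn ok Pn]] /=; have [gb Pg] := gP _ ok Pn.
  by rewrite size_rcons sn word_ok_rcons ok gb.
exists (g \o W) => n; first by have [sn ok Pn] := WP n; case: (gP _ ok Pn); rewrite sn.
suff -> : mkseq (g \o W) n = W n by case: (WP n).
by elim: n => // n IHn; rewrite mkseqS IHn.
Qed.

(** The requirements [Q i] are met one after the other by longer and longer words. Appending the
    letter 0 before each extension, legal by [b_gt0], forces the lengths to grow, so that the words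
    determine an infinite branch. *)
Lemma branch_of_ext (Q : nat -> seq nat -> Prop) :
  (forall i v, word_ok v -> exists w, [/\ word_ok w, prefix v w & Q i w]) ->
  exists2 f, (forall n, (f n < b n)%N) & forall i, exists n, Q i (mkseq f n).
Proof.
move=> step.
have /choice[g gP] : forall iv : nat * seq nat, exists w, word_ok iv.2 ->
    [/\ word_ok w, prefix (rcons iv.2 0%N) w & Q iv.1 w].
  move=> [i v] /=.
  have [vok|nok] := boolP (word_ok v); last by exists [::].
  have [|w wP] := step i (rcons v 0%N); first by rewrite word_ok_rcons vok b_gt0.
  by exists w.
pose W := fix W n := if n is n'.+1 then g (n', W n') else [::].
have Wok n : word_ok (W n) by elim: n => //= n IHn; case: (gP (n, W n) IHn).
have Wpre n : prefix (rcons (W n) 0%N) (W n.+1) by case: (gP (n, W n) (Wok n)).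
have Wsize n : (n <= size (W n))%N.
  elim: n => // n IHn; have := size_prefix (Wpre n).
  by rewrite size_rcons; apply: leq_trans.
have Wmono m n : (m <= n)%N -> prefix (W m) (W n).
  move=> mn; rewrite -(subnKC mn); elim: (n - m)%N => [|k IHk].
    by rewrite addn0 prefix_refl.
  rewrite addnS; apply: prefix_trans IHk _; apply: prefix_trans (Wpre _).
  by rewrite -cats1 prefix_prefix.
have nth_pre u w j : prefix u w -> (j < size u)%N -> nth 0%N w j = nth 0%N u j.
  by move=> /prefixP[t ->] ju; rewrite nth_cat ju.
(* [W n.+1] has length at least [n.+1], so its letter of index [n] is never changed later. *)
pose f n := nth 0%N (W n.+1) n.
have fW i : mkseq f (size (W i)) = W i.
  apply: (@eq_from_nth _ 0%N); first by rewrite size_mkseq.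
  move=> j; rewrite size_mkseq => ji; rewrite nth_mkseq// /f.
  have [jl|il] := leqP j.+1 i.
    by rewrite (nth_pre _ _ _ (Wmono _ _ jl)).
  by rewrite (nth_pre _ _ _ (Wmono _ _ (ltnW il))).
exists f => [n|i]; first by apply: word_ok_nth.
by exists (size (W i.+1)); rewrite fW; case: (gP (i, W i) (Wok i)).
Qed.

(* The subtraction is truncated: for [n <= size v] this is [p v]. *)
Definition ext_mean (R : realType) (p : pred (seq nat)) n v : R :=
  (count p (ext v (n - size v)))%:R / (size (ext v (n - size v)))%:R.

Lemma size_ext_gt0 v k : (0 < size (ext v k))%N.
Proof.
have := width_gt0 (size v + k); rewrite -size_ext.
by case: (size _).
Qed.

Lemma ext_mean_ge0 (R : realType) p n v : 0 <= ext_mean R p n v.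
Proof. by rewrite divr_ge0. Qed.

(** [ext_mean R p n v] is the probability that a uniformly random branch through [v] satisfies [p]
    at level [n]. Before level [n], its average over the children of [v] is its value at [v]; from
    level [n] on it is the indicator of [p], which can only decrease along a branch. *)
Lemma sum_ext_mean_child (R : realType) (p : pred (seq nat)) n v :
  word_ok v -> (forall u k, word_ok (rcons u k) -> p (rcons u k) -> p u) ->
  \sum_(i <- iota 0 (b (size v))) ext_mean R p n (rcons v i) <=
    (b (size v))%:R * ext_mean R p n v.
Proof.
move=> vok pmono; rewrite /ext_mean.
have [nv|vn] := leqP n (size v).
  rewrite (eqP nv) /= divr1 addn0.
  rewrite (_ : \sum_(i <- _) _ =
      \sum_(i <- iota 0 (b (size v))) (p (rcons v i))%:R); last first.
    apply: eq_bigr => i _; rewrite size_rcons.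
    by rewrite (eqP (leq_trans nv (leqnSn _) : n - (size v).+1 == 0)%N) /= divr1 addn0.
  rewrite (_ : (b (size v))%:R * _ =
      \sum_(i <- iota 0 (b (size v))) (p v)%:R); last first.
    by rewrite big_const_seq count_predT size_iota iter_addr_0 mulr_natl.
  rewrite big_seq [leRHS]big_seq; apply: ler_sum => i; rewrite mem_iota add0n /= => ib.
  have [pvi|//] := boolP (p (rcons v i)).
  by rewrite (pmono v i)// word_ok_rcons vok.
have [k nk] : exists k, (n - size v)%N = k.+1.
  by exists (n - size v).-1; rewrite prednK// subn_gt0.
rewrite nk; pose S := size (ext (rcons v 0%N) k).
have S_gt0 : (0 < S)%N by exact: size_ext_gt0.
have bv := b_gt0 (size v).
have sizeS i : size (ext (rcons v i) k) = S.
  apply/eqP; rewrite -(eqn_pmul2r (width_gt0 (size v).+1)).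
  have := size_ext (rcons v i) k; have := size_ext (rcons v 0%N) k.
  by rewrite !size_rcons => -> ->.
have sizebS : size (ext v k.+1) = (b (size v) * S)%N.
  apply/eqP; rewrite -(eqn_pmul2r (width_gt0 (size v))) size_ext addnS -addSn.
  have := size_ext (rcons v 0%N) k; rewrite size_rcons => <-.
  by rewrite /width big_ord_recr /= -[X in _ == X]mulnA [X in _ == X]mulnC -mulnA.
rewrite le_eqVlt; apply/orP; left; apply/eqP.
rewrite (eq_bigr (fun i => (count p (ext (rcons v i) k))%:R / S%:R)); last first.
  by move=> i _; rewrite size_rcons subnS nk /= sizeS.
rewrite -mulr_suml -natr_sum sizebS natrM.
rewrite [RHS](_ : _ = (count p (ext v k.+1))%:R / S%:R); last first.
  by field; rewrite !pnatr_eq0 -!lt0n S_gt0 bv.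
congr (_%:R * _); rewrite -sum1_count [RHS]big_mkcond [RHS]sum_ext_child.
by apply: eq_bigr => i _; rewrite -sum1_count [LHS]big_mkcond.
Qed.

(** Method of conditional expectations: [Phi v] is the expected number of indices [i] for which
    [p i] holds at level [n i] on a random branch through [v]. Some child always keeps it below 1,
    and at level [n i] the [i]-th term is 0 or 1, hence 0. *)
Lemma avoiding_branch (R : realType) (p : nat -> pred (seq nat)) (n : nat -> nat) :
  (forall i u k, word_ok (rcons u k) -> p i (rcons u k) -> p i u) ->
  (\sum_(0 <= i <oo) (ext_mean R (p i) (n i) [::])%:E < 1)%E ->
  exists2 f, (forall j, (f j < b j)%N) & forall i, ~~ p i (mkseq f (n i)).
Proof.
move=> pmono lt1.
pose Phi v := (\sum_(0 <= i <oo) (ext_mean R (p i) (n i) v)%:E)%E.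
have Phi_ge v i : ((ext_mean R (p i) (n i) v)%:E <= Phi v)%E.
  apply: le_trans (nneseries_lim_ge i.+1 _); last first.
    by move=> j _ _; rewrite lee_fin ext_mean_ge0.
  rewrite big_nat_recr//= leeDr// sume_ge0// => j _.
  by rewrite lee_fin ext_mean_ge0.
have [v vok Phiv|f fb fP] := @branch_of_step (fun v => (Phi v < 1)%E) lt1.
  apply: contrapT => nk.
  (* The average of [Phi] over the children is at most [Phi v < 1], so the children cannot all have
     value at least 1. *)
  have : (\sum_(0 <= k < b (size v)) Phi (rcons v k) <= (b (size v))%:R%:E * Phi v)%E.
    rewrite -nneseries_sum_nat; last by move=> *; rewrite lee_fin ext_mean_ge0.
    rewrite -nneseriesZl//; last by move=> *; rewrite lee_fin ext_mean_ge0.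
    apply: lee_nneseries => [i _ _|i _].
      by rewrite sume_ge0// => *; rewrite lee_fin ext_mean_ge0.
    rewrite sumEFin -EFinM lee_fin /index_iota subn0.
    exact: (sum_ext_mean_child _ _ vok (pmono i)).
  apply/negP; rewrite -ltNge.
  apply: (@lt_le_trans _ _ (b (size v))%:R%:E).
    rewrite -[ltRHS]mule1 lte_pmul2l ?lte_fin ?ltr0n//.
  rewrite (_ : _%:E = \sum_(0 <= k < b (size v)) 1%E)%E; last first.
    by rewrite sumEFin big_const_nat subn0 iter_addr_0.
  rewrite big_nat [leRHS]big_nat; apply: lee_sum => k /= kb.
  by rewrite leNgt; apply/negP => lt; apply: nk; exists k.
exists f => // i; apply/negP => pi.
have := fP (n i); rewrite ltNge => /negP; apply.
apply: le_trans (Phi_ge _ i).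
by rewrite /ext_mean size_mkseq subnn /= pi divr1.
Qed.

End words.

(** * Trees of balls *)

Lemma le_diam {R : realType} {X : metricType R} (U : set X) x y :
  U x -> U y -> ((mdist x y)%:E <= diam U)%E.
Proof. by move=> Ux Uy; apply: ereal_sup_ubound; right; exists (x, y). Qed.

Lemma diam_ge0 {R : realType} {X : metricType R} (U : set X) : (0 <= diam U)%E.
Proof. by apply: ereal_sup_ubound; left. Qed.

Lemma packing_content_ge0 {R : realType} {X : metricType R} s e (A : set X) :
  (0 <= packing_content s e A)%E.
Proof.
apply: ereal_sup_ubound; exists 0%N.
have h (T : Type) : 'I_0 -> T by case.
exists (h X), (h R); split; [by case|by case|by case|].
by rewrite big_ord0.
Qed.

Lemma packing_premeasure_ge0 {R : realType} {X : metricType R} s (A : set X) :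
  (0 <= packing_premeasure s A)%E.
Proof.
by apply/ereal_infP => _ [e _ <-]; exact: packing_content_ge0.
Qed.

Lemma count_has_le (S T : Type) (p : S -> pred T) (s : seq S) (t : seq T) k :
  (forall y, (count (p y) t <= k)%N) ->
  (count (fun w => has (p^~ w) s) t <= size s * k)%N.
Proof.
move=> pk; elim: s => [|y s IHs] /=; first by rewrite count_pred0.
rewrite mulSn; apply: leq_trans (leq_add (pk y) IHs).
by rewrite -count_predUI leq_addr.
Qed.

Section tree.
Context {R : realType} {X : completeMetricType R}.
Variables (mu : {measure set (borelType X) -> \bar R}) (delta a b r0 : R).
Hypothesis hmu : ahlfors_regular mu delta a b r0.
Hypothesis hr0 : 0 < r0.

Variables (br : nat -> nat) (c : seq nat -> X) (rad : nat -> R) (A : set X).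
Hypothesis br_gt0 : forall n, (0 < br n)%N.
Hypothesis rad_gt0 : forall n, 0 < rad n.
Hypothesis rad_cvg0 : forall e, 0 < e ->
  exists n0, forall n, (n0 <= n)%N -> rad n <= e.

Definition cell (w : seq nat) : set X := cball (c w) (rad (size w)).

Hypothesis cell_nested : forall w k,
  word_ok br (rcons w k) -> cell (rcons w k) `<=` cell w.
Hypothesis cell_siblings : forall w k l, word_ok br w ->
  (k < br (size w))%N -> (l < br (size w))%N -> k <> l ->
  cell (rcons w k) `&` cell (rcons w l) = set0.
Hypothesis cell_limit : forall f, (forall n, (f n < br n)%N) ->
  exists2 x, A x & forall n, cell (mkseq f n) x.

(** By induction on length: distinct parents already have disjoint cells containing these, and with
    a common parent the words are siblings. *)
Lemma cell_disjoint u v : word_ok br u -> word_ok br v -> size u = size v ->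
  u <> v -> cell u `&` cell v = set0.
Proof.
elim/last_ind: u v => [|u i IHu] v; first by move=> _ _ /esym/size0nil ->.
case/lastP: v => [|v j]; first by rewrite size_rcons.
move=> uok vok; rewrite !size_rcons => -[suv] uv.
have [/IHu|uv'] := pselect (u <> v); last first.
  have {}uv' : u = v by apply: contrapT.
  subst v; move: uok vok; rewrite !word_ok_rcons => /andP[uok iu] /andP[_ ju].
  by apply: cell_siblings => // ij; apply: uv; rewrite ij.
have uok' : word_ok br u by move: uok; rewrite word_ok_rcons => /andP[].
have vok' : word_ok br v by move: vok; rewrite word_ok_rcons => /andP[].
move=> /(_ uok' vok' suv) uv0; rewrite -subset0 => x [/(cell_nested uok) ux].
by move=> /(cell_nested vok) vx; rewrite -uv0.
Qed.

Definition meets (U : set X) : pred (seq nat) := fun w => `[< cell w `&` U !=set0 >].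

(* Bounds the number of disjoint balls of radius [rho] that meet a ball of radius
   [2 * rho], since they all lie in the concentric ball of radius [4 * rho]. *)
Definition multiplicity : R := b / a * 4 `^ delta.

Lemma multiplicity_gt0 : 0 < multiplicity.
Proof.
have [/andP[a0 a1] b1 _] := hmu.
by rewrite /multiplicity mulr_gt0 ?powR_gt0 ?divr_gt0// (lt_le_trans ltr01).
Qed.

Lemma meets_count v k y : word_ok br v -> 4 * rad (size v + k) <= r0 ->
  (count (meets (cball y (2 * rad (size v + k)))) (ext br v k))%:R
    <= multiplicity.
Proof.
move=> vok; set n := (size v + k)%N => rr.
have [/andP[a0 a1] b1 _] := hmu.
rewrite -size_filter; set s := seq.filter _ _.
have sP w : w \in s -> [/\ size w = n, word_ok br w &
    cell w `&` cball y (2 * rad n) !=set0].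
  rewrite mem_filter => /andP[/asboolP mw /(mem_ext vok)[]].
  by [].
have := @ahlfors_packing _ _ _ _ _ _ _ hmu _ s c y (rad n) (4 * rad n).
move=> /(_ (filter_uniq _ (ext_uniq _ _ _))).
have rn := rad_gt0 n.
rewrite rn mulr_gt0// rr andbT (le_trans _ rr); last by nra.
move=> /(_ isT isT) h.
have {h} : (size s)%:R * (a * rad n `^ delta) <= b * (4 * rad n) `^ delta.
  apply: h => [u v' /sP[su uok _] /sP[sv vok' _] /eqP uv|u /sP[su uok]].
    have := cell_disjoint uok vok'; rewrite /cell su sv; exact.
  (* A cell that meets the ball has its centre within [3 * rad n] of [y], hence lies in the ball of
     radius [4 * rad n]. *)
  rewrite /cell su => -[z [uz yz]]; apply: (@cball_sub _ _ _ y (2 * rad n + rad n)).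
    exact: cball_trans yz (cball_sym uz).
  by lra.
rewrite powRM ?(ltW rn)// mulrA mulrA ler_pM2r ?powR_gt0//.
by rewrite -ler_pdivlMr// => /le_trans; apply; rewrite /multiplicity mulrAC.
Qed.

Lemma meets_nested U w k :
  word_ok br (rcons w k) -> meets U (rcons w k) -> meets U w.
Proof.
move=> wok /asboolP[x [wx Ux]]; apply/asboolP; exists x; split => //.
exact: cell_nested wx.
Qed.

(** The bound pairs the width of level [n] with the radius of level [n.+1] because a set of the
    cover is tested at the level whose radius is just above its size, so only the next radius bounds
    that size from below. *)
Lemma hausdorff_measure_neq0 s C n0 : 0 < s -> 0 < C ->
  (forall n, (n0 <= n)%N -> C <= (width br n)%:R * rad n.+1 `^ s) ->
  hausdorff_measure s A <> 0%E.
Proof.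
move=> s0 C0 hC H0.
have content_le0 e : 0 < e -> (hausdorff_content s e A <= 0)%E.
  by move=> e0; rewrite -H0; apply: ereal_sup_ubound; exists e.
have [n1 n1r] := rad_cvg0 (divr_gt0 hr0 (ltr0n R 4)).
pose N := maxn n0 n1; pose Q := multiplicity.
have Q0 : 0 < Q by exact: multiplicity_gt0.
(* Chosen so that the final expectation is at most [Q / C * (t + t)], that is 1/2. *)
pose t := C / (4 * Q); have t0 : 0 < t by rewrite divr_gt0 // mulr_gt0.
have : (hausdorff_content s (rad N) A < t%:E)%E.
  by apply: le_lt_trans (content_le0 _ _) _; rewrite ?lte_fin.
move=> /ereal_inf_lt[_ [U [AU Ud] <-]] Ut.
pose dm i := fine (diam (U i)).
have dmE i : diam (U i) = (dm i)%:E.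
  rewrite fineK// ge0_fin_numE ?diam_ge0//.
  by apply: le_lt_trans (Ud i) _; rewrite ltry.
have dm_ge0 i : 0 <= dm i by rewrite -lee_fin -dmE diam_ge0.
have dm_le i : dm i <= rad N by rewrite -lee_fin -dmE.
pose eps i : R := t / (2 ^ i.+1)%:R.
have eps_gt0 i : 0 < eps i by rewrite divr_gt0// ltr0n expn_gt0.
(* A positive substitute for the diameter, which may vanish. It stays below [rad N], so that a level
   can be assigned to it, and the total error on the [s]-th powers is at most [t]. *)
pose d i := Num.max (dm i) (Num.min (rad N) (eps i `^ s^-1)).
have d_gt0 i : 0 < d i by rewrite /d lt_max lt_min rad_gt0 powR_gt0// orbT.
have d_le i : d i <= rad N by rewrite /d ge_max dm_le ge_min lexx.
have dm_d i : dm i <= d i by rewrite /d le_max lexx.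
have d_pow i : d i `^ s <= dm i `^ s + eps i.
  rewrite {1}/d; case: (leP (dm i)) => _; last by rewrite lerDl ltW.
  apply: (@le_trans _ _ (eps i)); last by rewrite lerDr powR_ge0.
  rewrite -[leRHS](powRr1 (ltW (eps_gt0 i))) -(@mulVf _ s) ?gt_eqF// powRrM.
  apply: ge0_ler_powR; rewrite ?nnegrE ?(ltW s0)// ?powR_ge0//.
    by rewrite le_min ltW ?rad_gt0// powR_ge0.
  by rewrite ge_min lexx orbT.
have level i : exists n, [/\ (N <= n)%N, d i <= rad n & rad n.+1 < d i].
  have [n2 n2r] := rad_cvg0 (divr_gt0 (d_gt0 i) (ltr0n R 2)).
  (* The first level from [N] on with radius below [d i] cannot be [N] itself; its predecessor is
     the level sought. *)
  have ex : exists n, (N <= n)%N && (rad n < d i).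
    exists (maxn N n2); rewrite leq_maxl /=; apply: le_lt_trans (n2r _ (leq_maxr _ _)) _.
    by rewrite ltr_pdivrMr// ltr_pMr// ltr1n.
  case: (ex_minnP ex) => -[|n] /andP[Nn rn] nmin.
    by move: Nn rn (d_le i); rewrite leqn0 => /eqP -> /lt_le_trans h /h; rewrite ltxx.
  have {}Nn : (N <= n)%N.
    rewrite leqNgt; apply/negP => nN; have NE : N = n.+1 by apply/eqP; rewrite eqn_leq Nn.
    by move: rn (d_le i); rewrite NE => /lt_le_trans h /h; rewrite ltxx.
  exists n; split => //; rewrite leNgt; apply/negP => rn'.
  by have := nmin n; rewrite Nn rn' ltnn => /(_ isT).
have /choice[lev levP] := level.
have [||f fb favoid] := @avoiding_branch br br_gt0 R (fun i => meets (U i)) lev.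
- by move=> i u k; exact: meets_nested.
- apply: (@le_lt_trans _ _ 
    (\sum_(0 <= i <oo) ((Q / C)%:E * (diam (U i) `^ s + (eps i)%:E)))%E).
    apply: lee_nneseries => [i _ _|i _]; first by rewrite lee_fin ext_mean_ge0.
    have [Nl dl ld] := levP i.
    rewrite dmE poweR_EFin -EFinD -EFinM lee_fin.
    apply: (@le_trans _ _ (Q / C * d i `^ s)); last first.
      by rewrite ler_pM2l// divr_gt0.
    (* If [U i] meets some cell, it lies in the ball of radius [2 * rad (lev i)] about one of its
       points, and [meets_count] applies. *)
    have cnt : (count (meets (U i)) (ext br [::] (lev i)))%:R <= Q.
      have [|] := boolP (has (meets (U i)) (ext br [::] (lev i))); last first.
        by rewrite has_count -eqn0Ngt => /eqP ->; rewrite ltW.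
      move=> /hasP[w wext /asboolP[u [wu Uu]]].
      apply: le_trans (@meets_count [::] (lev i) u isT _).
        rewrite ler_nat; apply: sub_count => w' /asboolP[x [wx Ux]].
        apply/asboolP; exists x; split => //; rewrite /cball /= add0n.
        rewrite -lee_fin; apply: le_trans (le_diam Uu Ux) _; rewrite dmE lee_fin.
        by have := rad_gt0 (lev i); have := dm_d i; lra.
      have := n1r (lev i) (leq_trans (leq_maxr _ _) Nl).
      by rewrite ler_pdivlMr// add0n mulrC.
    rewrite /ext_mean subn0; have := size_ext br [::] (lev i).
    rewrite /= /width big_ord0 muln1 add0n => ->; rewrite -/(width br (lev i)).
    have w0 : 0 < (width br (lev i))%:R :> R by rewrite ltr0n width_gt0.
    rewrite ler_pdivrMr//; apply: le_trans cnt _.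
    (* At most [Q] cells are met, out of a number which is at least [C] divided by the [s]-th power
       of [d i], since [rad (lev i).+1 < d i]. *)
    have hCi := hC (lev i) (leq_trans (leq_maxl _ _) Nl).
    have rd : rad (lev i).+1 `^ s <= d i `^ s.
      by apply: ge0_ler_powR; rewrite ?nnegrE ?ltW.
    rewrite [leRHS](_ : _ = Q * ((width br (lev i))%:R * d i `^ s / C)); last by ring.
    rewrite ler_peMr ?(ltW Q0)// ler_pdivlMr// mul1r.
    by apply: le_trans hCi _; rewrite ler_pM2l.
  rewrite nneseriesZl//; last first.
    by move=> i _; rewrite adde_ge0 ?poweR_ge0 ?lee_fin ?(ltW (eps_gt0 i)).
  apply: (@le_lt_trans _ _ ((Q / C)%:E * (t%:E + t%:E))%E).
    rewrite lee_pmul2l ?lte_fin ?divr_gt0//.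
    apply: le_trans (epsilon_trick _ _ (ltW t0)) _; first by move=> i; exact: poweR_ge0.
    by rewrite leeD2r// ltW.
  rewrite -EFinD -EFinM lte_fin /t.
  rewrite (_ : _ * _ = 2^-1); first by rewrite invf_lt1// ltr1n.
  by field; rewrite !gt_eqF.
have [x Ax xf] := cell_limit fb.
have [i _ Ux] := AU x Ax.
have /negP := favoid i; apply; apply/asboolP; exists x; split => //.
Qed.

Lemma packing_avoid s e F v : 0 < s -> 0 < e ->
  (forall Y n0, exists2 n, (n0 <= n)%N & Y <= (width br n)%:R * rad n `^ s) ->
  (packing_content s e F < 1)%E -> word_ok br v ->
  exists w, [/\ word_ok br w, prefix v w & cell w `&` F = set0].
Proof.
move=> s0 e0 big lt1 vok; apply: contrapT => nw.
have meetF k w : w \in ext br v k -> exists2 z, F z & cell w z.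
  move=> /(mem_ext vok)[_ wok vw]; apply: contrapT => nz; apply: nw.
  exists w; split => //; rewrite -subset0 => z [wz Fz]; apply: nz.
  by exists z.
have [n1 n1r] := rad_cvg0 (divr_gt0 hr0 (ltr0n R 4)).
have [n2 n2r] := rad_cvg0 e0.
pose q := (Num.trunc multiplicity).+1.
have multq : multiplicity < q%:R by exact: truncnS_gt.
(* This value cancels the multiplicity [q] and the number of words at the level of [v], which makes
   the final packing sum at least 1. *)
have [n nN bign] := big (q%:R * (width br (size v))%:R) (maxn (size v) (maxn n1 n2)).
move: nN; rewrite !geq_max => /and3P[vn n1n n2n].
pose k := (n - size v)%N; pose L := ext br v k.
have nE : n = (size v + k)%N by rewrite subnKC.
have rn : 4 * rad n <= r0 by have := n1r n n1n; rewrite ler_pdivlMr// mulrC.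
have r_gt0 := rad_gt0 n.
have exm : exists m, (size L <= m * q)%N by exists (size L); rewrite leq_pmulr.
(* [m] is the quotient of [size L] by [q], rounded up: fewer than [m] balls of radius [2 * rad n]
   meet fewer than [size L] cells, so some cell provides a further separated point of [F]. *)
case: (ex_minnP exm) => m Lm mmin.
have [S Sm SF|S [Sm SF Spw]] := @greedy_separated _ _ F (2 * rad n) m.
  apply: contrapT => nz.
  have : (size L <= size S * q)%N; last first.
    by move=> /mmin; rewrite leqNgt Sm.
  have mc y : (count (meets (cball y (2 * rad n))) L <= q)%N.
    rewrite -(ler_nat R); apply: le_trans (ltW multq).
    by rewrite nE; apply: meets_count => //; rewrite -nE.
  apply: leq_trans (count_has_le S mc).
  rewrite leq_eqVlt; apply/orP; left; rewrite eq_sym -all_count.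
  apply/allP => w wL; apply/negPn/negP => /hasPn nhas; apply: nz.
  have [z Fz wz] := meetF k w wL; exists z => // y yS.
  rewrite ltNge; apply/negP => zy; have /asboolPn := nhas y yS; apply.
  by exists z; split => //; exact: cball_sym.
have : (((m%:R * (2 * rad n) `^ s)%:E) <= packing_content s e F)%E.
  apply: ereal_sup_ubound; exists m, (fun i => nth (c [::]) S i), (fun=> rad n).
  split.
  - by move=> i; apply: SF; rewrite mem_nth ?Sm.
  - by move=> i; rewrite r_gt0 n2r.
  - move=> i j _ _ [z [iz jz]]; apply/eqP; rewrite -[_ == _]negbK; apply/negP => ij.
    have sep u w : (u < w < m)%N ->
        2 * rad n < mdist (nth (c [::]) S u) (nth (c [::]) S w).
      move=> /andP[uw wm]; apply: (pairwiseP (c [::]) Spw) => //; rewrite inE Sm//.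
      exact: ltn_trans wm.
    have : (cball (nth (c [::]) S i) (rad n) `&`
            cball (nth (c [::]) S j) (rad n)) z by [].
    have [ij'|ji|/val_inj ij'] := ltngtP i j; last by rewrite ij' eqxx in ij.
      by rewrite disjoint_cball// sep// ij' ltn_ord.
    by rewrite setIC disjoint_cball// sep// ji ltn_ord.
  - by congr EFin; rewrite sumr_const card_ord mulr_natl.
move=> /le_lt_trans /(_ lt1); rewrite lte_fin ltNge => /negP; apply.
have q0 : 0 < q%:R :> R by rewrite ltr0n.
have w0 : 0 < (width br (size v))%:R :> R by rewrite ltr0n width_gt0.
rewrite -(ler_pM2l (mulr_gt0 q0 w0)) mulr1; apply: le_trans bign _.
rewrite powRM ?(ltW r_gt0)//.
have rs0 : 0 < rad n `^ s by rewrite powR_gt0.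
have two1 : 1 <= 2 `^ s :> R.
  by have := @ler_powR R 2 _ 0 s (ltW s0); rewrite powRr0; apply; rewrite ler1n.
apply: (@le_trans _ _ (q%:R * (width br (size v))%:R * (m%:R * rad n `^ s))).
  rewrite mulrA ler_pM2r// nE -size_ext -/k -/L -!natrM ler_nat.
  by rewrite [leqRHS]mulnAC leq_mul2r mulnC Lm orbT.
rewrite ler_pM2l ?mulr_gt0// ler_wpM2l// ler_peMl// ltW//.
Qed.

(** A Baire-type argument: each set of the cover has small packing content at some scale, so it can
    be avoided below any word, and one branch avoids them all while its limit point lies in [A]. *)
Lemma packing_measure_neq0 s : 0 < s ->
  (forall Y n0, exists2 n, (n0 <= n)%N & Y <= (width br n)%:R * rad n `^ s) ->
  packing_measure s A <> 0%E.
Proof.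
move=> s0 big P0.
have : (packing_measure s A < 1)%E by rewrite P0.
move=> /ereal_inf_lt[_ [F AF <-]] F1.
have Fi i : (packing_premeasure s (F i) < 1)%E.
  apply: le_lt_trans F1.
  apply: le_trans (nneseries_lim_ge i.+1 _); last first.
    by move=> j _ _; exact: packing_premeasure_ge0.
  by rewrite big_nat_recr//= leeDr// sume_ge0// => j _; exact: packing_premeasure_ge0.
have [i v vok|f fb fF] := @branch_of_ext br br_gt0 (fun i w => cell w `&` F i = set0).
  have /ereal_inf_lt[_ [e /= e0 <-] Fe] := Fi i.
  exact: packing_avoid e0 big Fe vok.
have [x Ax xf] := cell_limit fb.
have [i _ Fx] := AF x Ax.
have [n fn] := fF i.
have : (cell (mkseq f n) `&` F i) x by [].
by rewrite fn.
Qed.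

End tree.

(** * The tree of plays *)

Section turns.
Variables (N Rr : nat -> nat).
Hypothesis hN : forall i j, (i < j)%N -> (N i < N j)%N.

Definition rapid n : bool := `[< exists j, n = N j >].

(** Exponent of [beta] in the change of radius at turn [n]; [xget] recovers the index [j] with
    [n = N j], unique by [N_inj]. *)
Definition shrink n : nat :=
  if rapid n then Rr (xget 0%N [set j | n = N j]) else 1%N.

Definition depth n := (\sum_(i < n) shrink i)%N.

Definition ordinary n := (\sum_(i < n) ~~ rapid i)%N.

Lemma N_inj : injective N.
Proof.
move=> i j Nij; have [ij|ji|//] := ltngtP i j.
  by have := hN ij; rewrite Nij ltnn.
by have := hN ji; rewrite Nij ltnn.
Qed.

Lemma rapidN j : rapid (N j).
Proof. by apply/asboolP; exists j. Qed.

Lemma shrinkN j : shrink (N j) = Rr j.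
Proof.
rewrite /shrink rapidN; congr Rr.
by case: xgetP => [i _ /= /N_inj ->|/(_ j) []].
Qed.

Lemma shrink_ordinary n : ~~ rapid n -> shrink n = 1%N.
Proof. by rewrite /shrink => /negbTE ->. Qed.

(** Here [j] is the number of rapid turns before [n]. Each adds [Rr i] to the depth, each of the
    other turns adds 1; the additive form avoids truncated subtraction. *)
Lemma turns_count n j :
  (forall i, (i < j)%N -> (N i < n)%N) -> (forall i, (j <= i)%N -> (n <= N i)%N) ->
  (ordinary n + j = n /\ depth n + j = n + \sum_(i < j) Rr i)%N.
Proof.
elim: n j => [|n IHn] j jn nj.
  case: j jn nj => [_ _|j /(_ 0%N (ltn0Sn _))//].
  by rewrite /ordinary /depth !big_ord0.
rewrite /ordinary /depth !big_ord_recr /= -/(ordinary n) -/(depth n).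
have [/asboolP[i nE]|nr] := boolP (rapid n); last first.
  have [||oE dE] := IHn j.
  - move=> i ij; rewrite ltn_neqAle -ltnS jn// andbT.
    by apply: contra nr => /eqP <-; exact: rapidN.
  - by move=> i ji; apply: ltnW; exact: nj.
  by rewrite shrink_ordinary//= !addn1 !addSn oE dE.
have ij : (i < j)%N by rewrite ltnNge; apply/negP => /nj; rewrite nE ltnn.
have jE : j = i.+1.
  apply/eqP; rewrite eqn_leq ij andbT leqNgt; apply/negP => /jn.
  by rewrite nE ltnS leqNgt hN.
subst j; have [||oE dE] := IHn i.
- by move=> k ki; rewrite nE; exact: hN.
- move=> k; rewrite leq_eqVlt nE => /predU1P[->//|/hN /ltnW//].
by rewrite big_ord_recr /= [in shrink n]nE shrinkN addn0 !addnS oE addnAC dE addSn addnA.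
Qed.

Hypothesis hR0 : forall i, (0 < Rr i)%N.

Lemma depth_ge n : (n <= depth n)%N.
Proof.
elim: n => // n IHn; rewrite /depth big_ord_recr /= -addn1 leq_add//.
by rewrite /shrink; case: ifP.
Qed.

End turns.

(** * Plays against a winning strategy, coded by words *)

Section game_tree.
Context {R : realType} {X : completeMetricType R}.
Variables (mu : {measure set (borelType X) -> \bar R}) (delta a b r0 : R).
Variables (beta rho : R) (PP : set (set X)) (N Rr : nat -> nat) (S : set X).
Hypothesis hmu : ahlfors_regular mu delta a b r0.
Hypothesis hr0 : 0 < r0.
Hypothesis hN : forall i j, (i < j)%N -> (N i < N j)%N.
Hypothesis hR0 : forall i, (0 < Rr i)%N.
Hypothesis beta_gt0 : 0 < beta.
Hypothesis beta_le : 4 * beta <= 1.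
Variables (sigma : strategy X) (x : X) (r : R) (m : nat).
Hypothesis rho_gt0 : 0 < rho.
Hypothesis hr : rho <= r < r0.
Hypothesis m_gt0 : (0 < m)%N.
Hypothesis hsigma : winning_strategy N Rr beta rho PP sigma S.
Variable kids : gball X -> set X -> seq X.
Hypothesis kidsP : forall B P, PP P -> 0 < Defs.radius B < r0 ->
  [/\ size (kids B P) = m,
    forall y, y \in kids B P ->
      cball y (beta * Defs.radius B) `<=` gset B `\` nbhood P (beta * Defs.radius B) &
    pairwise (fun y z => 2 * (beta * Defs.radius B) < mdist y z) (kids B P)].

Let B0 := GBall x r.

(** The ball following the history [h], which has one more entry than the turn number. The letter
    [k] selects one of Bob's legal balls; on a rapid turn it is ignored, as Alice imposes the
    ball. *)
Definition answer (h : seq (gball X)) (k : nat) : gball X :=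
  let B := last B0 h in let n := (size h).-1 in
  GBall (if rapid N n then chosen_centre sigma h
         else nth (centre B) (kids B (removed_set sigma h)) k)
        (beta ^+ shrink N Rr n * Defs.radius B).

Definition hist (w : seq nat) : seq (gball X) :=
  foldl (fun h k => rcons h (answer h k)) [:: B0] w.

Definition pos w := last B0 (hist w).

Definition branching n := if rapid N n then 1%N else m.

Definition turn_radius n := beta ^+ depth N Rr n * r.

Lemma r_gt0 : 0 < r.
Proof. by case/andP: hr => /(lt_le_trans rho_gt0). Qed.

Lemma branching_gt0 n : (0 < branching n)%N.
Proof. by rewrite /branching; case: ifP. Qed.

Lemma turn_radius_gt0 n : 0 < turn_radius n.
Proof. by rewrite mulr_gt0 ?exprn_gt0// r_gt0. Qed.

Lemma beta_lt1 : beta < 1.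
Proof. by have := beta_gt0; have := beta_le; lra. Qed.

Lemma turn_radius_lt n : turn_radius n < r0.
Proof.
case/andP: hr => _; apply: le_lt_trans; rewrite ler_piMl ?(ltW r_gt0)//.
by rewrite exprn_ile1 ?ltW// beta_lt1.
Qed.

Lemma hist_rcons w k : hist (rcons w k) = rcons (hist w) (answer (hist w) k).
Proof. by rewrite /hist foldl_rcons. Qed.

Lemma size_hist w : size (hist w) = (size w).+1.
Proof. by elim/last_ind: w => // w k IHw; rewrite hist_rcons !size_rcons IHw. Qed.

Lemma pos_rcons w k : pos (rcons w k) = answer (hist w) k.
Proof. by rewrite /pos hist_rcons last_rcons. Qed.

Lemma radius_pos w : Defs.radius (pos w) = turn_radius (size w).
Proof.
elim/last_ind: w => [|w k IHw]; first by rewrite /turn_radius /depth big_ord0 expr0 mul1r.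
rewrite pos_rcons /= -/(pos w) IHw size_hist size_rcons /= /turn_radius.
by rewrite /depth big_ord_recr /= exprD mulrA (mulrC (beta ^+ _)).
Qed.

Definition play (f : nat -> nat) n := pos (mkseq f n).

Lemma history_play f n : history (play f) n = hist (mkseq f n).
Proof.
elim: n => [|n IHn]; first by [].
by rewrite /history mkseqS -/(history _ _) IHn [in RHS]mkseqS hist_rcons
  /play mkseqS pos_rcons.
Qed.

Lemma play_step f n :
  play f n.+1 = answer (history (play f) n) (f n).
Proof. by rewrite /play mkseqS pos_rcons history_play. Qed.

Lemma play_radius f n : Defs.radius (play f n) = turn_radius n.
Proof. by rewrite /play radius_pos size_mkseq. Qed.

Lemma last_history f n : last B0 (history (play f) n) = play f n.
Proof. by rewrite history_play. Qed.

Lemma size_history (B : nat -> gball X) n : size (history B n) = n.+1.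
Proof. by rewrite /history size_mkseq. Qed.

Lemma kids_play f n : ~~ rapid N n ->
  alice_turn N Rr beta PP sigma (play f) n ->
  let P := removed_set sigma (history (play f) n) in
  [/\ size (kids (play f n) P) = m,
    forall y, y \in kids (play f n) P ->
      cball y (beta * Defs.radius (play f n)) `<=`
        gset (play f n) `\` nbhood P (beta * Defs.radius (play f n)) &
    pairwise (fun y z => 2 * (beta * Defs.radius (play f n)) < mdist y z)
      (kids (play f n) P)].
Proof.
move=> nr [_ aPP] P; apply: kidsP.
  by apply: aPP => j nj; move: nr; rewrite nj rapidN.
by rewrite play_radius turn_radius_gt0 turn_radius_lt.
Qed.

Lemma play_turn f n : (f n < branching n)%N ->
  alice_turn N Rr beta PP sigma (play f) n ->
  bob_turn N Rr beta sigma (play f) n /\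
  gset (play f n.+1) `<=` gset (play f n).
Proof.
move=> fn alice; have [/asboolP[j nE]|nr] := boolP (rapid N n).
  have stepE : play f n.+1 = alice_ball Rr beta sigma (play f) n j.
    rewrite play_step /answer last_history size_history /=.
    by rewrite [in rapid N n]nE rapidN [in shrink N Rr n]nE shrinkN.
  split; last by rewrite stepE; apply: alice.1.
  split; last by move=> /(_ j).
  by move=> i ni; rewrite stepE (@N_inj N hN i j) // -ni.
have [km ksub _] := kids_play nr alice.
have sub : gset (play f n.+1) `<=` gset (play f n) `\`
    nbhood (removed_set sigma (history (play f) n)) (beta * Defs.radius (play f n)).
  rewrite play_step /answer last_history size_history /= (negbTE nr).
  rewrite shrink_ordinary// expr1; apply: ksub; apply: mem_nth.
  by rewrite km; move: fn; rewrite /branching (negbTE nr).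
split; last by move=> y /sub[].
split; first by move=> j nj; move: nr; rewrite nj rapidN.
move=> _; split => //.
by rewrite play_step /answer last_history size_history /= shrink_ordinary// expr1.
Qed.

(** Bob's move at turn [n] is legal if Alice's is, and hers is legal because the position is
    reached; the two facts advance together by induction. *)
Lemma play_reached f n : (forall k, (f k < branching k)%N) ->
  reached N Rr beta rho sigma (play f) n.
Proof.
move=> fb; elim: n => [|n IHn]; first by split => //; case/andP: hr.
case: (IHn) => h0 hk; split => // k; rewrite ltnS leq_eqVlt => /predU1P[->|/hk//].
by case: (play_turn (fb n)) => //; exact: hsigma.1.
Qed.

Lemma play_alice f n : (forall k, (f k < branching k)%N) ->
  alice_turn N Rr beta PP sigma (play f) n.
Proof. by move=> fb; apply: hsigma.1; exact: play_reached. Qed.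

Lemma play_nested f n : (forall k, (f k < branching k)%N) ->
  gset (play f n.+1) `<=` gset (play f n).
Proof. by move=> fb; case: (play_turn (fb n) (play_alice n fb)). Qed.

Let c w := centre (pos w).

Lemma cellE w : cell c turn_radius w = gset (pos w).
Proof. by rewrite /cell /gset radius_pos. Qed.

Lemma mkseq_nth_rcons w k :
  mkseq (nth 0%N (rcons w k)) (size w) = w.
Proof.
apply: (@eq_from_nth _ 0%N); rewrite size_mkseq// => i iw.
by rewrite nth_mkseq// nth_rcons iw.
Qed.

Lemma game_nested w k :
  word_ok branching (rcons w k) ->
  cell c turn_radius (rcons w k) `<=` cell c turn_radius w.
Proof.
move=> wok; rewrite !cellE.
(* Continued by zeros, the word codes an infinite play, to which the facts about plays apply. *)
have fb i := word_ok_nth branching_gt0 i wok.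
have := @play_nested _ (size w) fb; rewrite /play mkseqS mkseq_nth_rcons.
by rewrite nth_rcons ltnn eqxx.
Qed.

Lemma game_siblings w k l : word_ok branching w ->
  (k < branching (size w))%N -> (l < branching (size w))%N -> k <> l ->
  cell c turn_radius (rcons w k) `&` cell c turn_radius (rcons w l) = set0.
Proof.
wlog kl : k l / (k < l)%N => [hw|] wok kb lb nkl.
  have [kl|lk|//] := ltngtP k l; first exact: hw.
  by rewrite setIC; apply: hw => // /esym.
move: kb lb; rewrite /branching; have [_|nr kb lb] := boolP (rapid N (size w)).
  by rewrite !ltnS !leqn0 => /eqP k0 /eqP l0; rewrite k0 l0 in nkl.
have fb i := word_ok_nth branching_gt0 i wok.
have hw : mkseq (nth 0%N w) (size w) = w by exact: mkseq_nth.
have [km _ ps] := kids_play nr (play_alice (size w) fb).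
rewrite !cellE /gset !radius_pos !pos_rcons !size_rcons.
rewrite /answer /= size_hist /= (negbTE nr) -/(pos w).
move: km ps; rewrite history_play play_radius /play hw => km ps.
have radS : turn_radius (size w).+1 = beta * turn_radius (size w).
  by rewrite /turn_radius /depth big_ord_recr /= shrink_ordinary//
    exprD expr1 mulrA (mulrC _ beta).
rewrite radS (set_nth_default (centre (pos w)) (centre (pos w))) ?km//.
apply: disjoint_cball; apply: (pairwiseP _ ps) => //; by rewrite inE km.
Qed.

(** Every coded play is infinite and legal, so its centres converge to a point of [S]; from turn [n]
    on they stay in the closed ball of turn [n], hence so does the limit. *)
Lemma game_limit f : (forall n, (f n < branching n)%N) ->
  exists2 y, (S `&` cball x r) y & forall n, cell c turn_radius (mkseq f n) y.
Proof.
move=> fb; have [y yl Sy] := hsigma.2 (play f) (fun n => play_reached n fb).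
have mono n k : gset (play f (n + k)) `<=` gset (play f n).
  elim: k => [|k IHk]; first by rewrite addn0.
  by rewrite addnS; apply: subset_trans IHk; exact: play_nested.
have yin n : gset (play f n) y.
  apply: (closed_cvg (gset (play f n)) (@closed_cball _ _ _ _) _ _ yl).
  exists n => // k /= nk; rewrite -(subnKC nk); apply: (mono n (k - n)%N).
  by apply: cball_center; rewrite play_radius ltW// turn_radius_gt0.
exists y; first by split => //; exact: (yin 0%N).
by move=> n; rewrite cellE; exact: yin.
Qed.

Lemma turn_radius_cvg0 e : 0 < e ->
  exists n0, forall n, (n0 <= n)%N -> turn_radius n <= e.
Proof.
move=> e0; have : GRing.exp (beta : R^o) @ \oo --> (0 : R^o).
  by apply: cvg_expr; rewrite gtr0_norm// beta_lt1.
move=> /cvgr0Pnorm_le/(_ (e / r) (divr_gt0 e0 r_gt0))[n0 _ hn0].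
exists n0 => n nn; rewrite -ler_pdivlMr ?r_gt0//.
apply: le_trans (hn0 n nn); rewrite ger0_norm ?exprn_ge0 ?(ltW beta_gt0)//.
by rewrite ler_iXn2l ?beta_lt1//; exact: depth_ge.
Qed.

Lemma game_hausdorff s C n0 : 0 < s -> 0 < C ->
  (forall n, (n0 <= n)%N -> C <= (width branching n)%:R * turn_radius n.+1 `^ s) ->
  hausdorff_measure s (S `&` cball x r) <> 0%E.
Proof.
exact: (hausdorff_measure_neq0 hmu hr0 branching_gt0 turn_radius_gt0 turn_radius_cvg0
  game_nested game_siblings game_limit).
Qed.

Lemma game_packing s : 0 < s ->
  (forall Y n0, exists2 n, (n0 <= n)%N &
     Y <= (width branching n)%:R * turn_radius n `^ s) ->
  packing_measure s (S `&` cball x r) <> 0%E.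
Proof.
exact: (packing_measure_neq0 hmu hr0 branching_gt0 turn_radius_gt0 turn_radius_cvg0
  game_nested game_siblings game_limit).
Qed.

End game_tree.

(** * Exponents *)

Lemma lt_limn_einf (R : realType) (u : (\bar R)^nat) l : (l < limn_einf u)%E ->
  exists n0, forall n, (n0 <= n)%N -> (l < u n)%E.
Proof.
rewrite limn_einf_lim (cvg_lim _ (ereal_nondecreasing_cvgn (nondecreasing_einfs u)))//.
move=> /ereal_sup_gt[_ [n0 _ <-]] lt; exists n0 => n nn.
by apply: lt_le_trans lt _; apply: ereal_inf_lbound; exists n.
Qed.

Lemma lt_limn_esup (R : realType) (u : (\bar R)^nat) l : (l < limn_esup u)%E ->
  forall n0, exists2 n, (n0 <= n)%N & (l < u n)%E.
Proof.
rewrite limn_esup_lim (cvg_lim _ (ereal_nonincreasing_cvgn (nonincreasing_esups u)))//.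
move=> lt n0; have : (l < esups u n0)%E.
  by apply: lt_le_trans lt _; apply: ereal_inf_lbound; exists n0.
by move=> /ereal_sup_gt[_ [n /= nn <-] lun]; exists n.
Qed.

Section exponents.
Context {R : realType}.
Variables (delta a b eta C beta : R).
Let K := 2^-1 * (a / b) * (4^-1) `^ delta
         - C * (b / a) * 2 `^ (eta + 1) * beta `^ eta.
Let D := delta - ln K / ln beta.
Hypotheses (a_gt0 : 0 < a) (a_le1 : a <= 1) (b_ge1 : 1 <= b)
  (eta_gt0 : 0 < eta) (C_gt0 : 0 < C) (delta_ge0 : 0 <= delta).
Hypothesis hbeta : 0 < beta < 1.
Hypothesis hbeta_small : beta <
  (C^-1 * (a ^+ 2 / b ^+ 2) * 2 `^ (- 2 * delta - eta - 2)) `^ eta^-1.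

Let b_gt0 : 0 < b. Proof. exact: lt_le_trans b_ge1. Qed.

(** The upper bound on [beta] is the number whose power of exponent [eta] makes the two terms of [K]
    equal. *)
Lemma ratio_gt0 : 0 < K.
Proof.
have [beta0 _] := andP hbeta.
rewrite subr_gt0.
have hz := hbeta_small; set z := C^-1 * _ * _ in hz.
have z0 : 0 < z by rewrite /z !mulr_gt0 ?invr_gt0 ?exprn_gt0 ?powR_gt0.
have bz : beta `^ eta < z.
  rewrite -[ltRHS](powRr1 (ltW z0)) -(@mulVf _ eta) ?gt_eqF// powRrM.
  by apply: gt0_ltr_powR; rewrite ?nnegrE ?powR_ge0 ?ltW.
have c0 : 0 < C * (b / a) * 2 `^ (eta + 1) by rewrite !mulr_gt0 ?invr_gt0 ?powR_gt0.
rewrite [ltRHS](_ : _ = C * (b / a) * 2 `^ (eta + 1) * z) ?ltr_pM2l// /z.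
have -> : (4^-1 : R) `^ delta = 2 `^ (- 2 * delta).
  rewrite powRrM; congr (_ `^ _); rewrite powRN (@powR_mulrn _ 2 2)//.
  by congr (_^-1); ring.
have -> : - 2 * delta - eta - 2 = - 2 * delta + - (eta + 1) + - 1 by ring.
move: (eta + 1) => w; rewrite !powRD ?pnatr_eq0 ?implybT// (powRN _ w) powR_inv1//.
have : 2 `^ w != 0 :> R by rewrite gt_eqF// powR_gt0.
move: (2 `^ w) (2 `^ (- 2 * delta)) => u v u0.
by field; rewrite u0 !gt_eqF ?b_gt0.
Qed.

Lemma powR_exponent : beta `^ (- D) = beta `^ (- delta) * K.
Proof.
have [beta0 beta1] := andP hbeta.
rewrite /D opprB addrC powRD ?(gt_eqF beta0) ?implybT//; congr (_ * _).
rewrite /powR gt_eqF// divfK ?lnK//; first by rewrite posrE ratio_gt0.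
by rewrite lt_eqF// ln_lt0// hbeta.
Qed.

(** Positivity of [D] means that [K] exceeds [beta ^ delta], while [K] is less than [(1/4) ^ delta].
    This yields the smallness of [beta] required by [separated_children]. *)
Lemma exponent_gt0 : 0 < D -> 4 * beta <= 1.
Proof.
have [beta0 beta1] := andP hbeta.
have lnb : ln beta < 0 by rewrite ln_lt0.
rewrite subr_gt0 ltr_ndivrMr// => dK; rewrite leNgt; apply/negP => b4.
have : ln K < delta * ln (4^-1).
  rewrite -ln_powR ltr_ln ?posrE ?ratio_gt0 ?powR_gt0//.
  have t0 : 0 < (4^-1 : R) `^ delta by rewrite powR_gt0.
  apply: (@le_lt_trans _ _ (2^-1 * (a / b) * (4^-1) `^ delta)).
    by rewrite gerBl !mulr_ge0 ?invr_ge0 ?powR_ge0 ?(ltW b_gt0) ?(ltW a_gt0) ?(ltW C_gt0).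
  rewrite gtr_pMl//; apply: (@le_lt_trans _ _ 2^-1); last first.
    by rewrite invf_lt1// ltr1n.
  by rewrite ler_piMr// ler_pdivrMr// mul1r (le_trans a_le1).
move=> /(lt_trans dK); apply/negP; rewrite -leNgt ler_wpM2l//.
by rewrite ler_ln ?posrE ?invr_gt0//; move: b4; lra.
Qed.

End exponents.

(** * Ordinary turns compared with depth, and the growth of the tree *)

Section turn_ratio.
Context {R : realType}.
Variables (N Rr : nat -> nat).
Hypothesis hN : forall i j, (i < j)%N -> (N i < N j)%N.
Hypothesis hR0 : forall i, (0 < Rr i)%N.

Lemma N_leq i j : (i <= j)%N -> (N i <= N j)%N.
Proof. by rewrite leq_eqVlt => /predU1P[->//|/hN/ltnW]. Qed.

Lemma leq_N i : (i <= N i)%N.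
Proof. by elim: i => // i IHi; apply: leq_ltn_trans IHi (hN _). Qed.

Lemma ordinary_le n : (ordinary N n <= n)%N.
Proof.
elim: n => [|n IHn]; first by rewrite /ordinary big_ord0.
rewrite /ordinary big_ord_recr /= -addn1 leq_add//.
by case: rapid.
Qed.

(** By [turns_count] the denominator is the depth, and removing the sum of the [Rr i] from it leaves
    the number of ordinary turns. *)
Lemma turn_ratio n j : (0 < n)%N ->
  (forall i, (i < j)%N -> (N i < n)%N) -> (forall i, (j <= i)%N -> (n <= N i)%N) ->
  1 - (\sum_(i < j) Rr i)%N%:R / (n%:R + \sum_(i < j) ((Rr i)%:R - 1)) =
  (ordinary N n)%:R / (depth N Rr n)%:R :> R.
Proof.
move=> n0 jn nj; have [oE dE] := turns_count Rr hN jn nj.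
have d0 : (0 < depth N Rr n)%N by apply: leq_trans (depth_ge N hR0 n).
have -> : n%:R + \sum_(i < j) ((Rr i)%:R - 1) = (depth N Rr n)%:R :> R.
  rewrite sumrB -natr_sum sumr_const card_ord addrA -natrD -dE natrD.
  by rewrite -mulr_natl mulr1 addrK.
have dn0 : (depth N Rr n)%:R != 0 :> R by rewrite pnatr_eq0 -lt0n.
rewrite -[X in X - _](divff dn0) -mulrBl; congr (_ / _).
apply/eqP; rewrite subr_eq -natrD eqr_nat; apply/eqP; apply/(@addIn j).
by rewrite dE -{1}oE addnAC.
Qed.

Lemma turn_ratio_after j :
  1 - (\sum_(i < j.+1) Rr i)%N%:R / ((N j)%:R + 1 + \sum_(i < j.+1) ((Rr i)%:R - 1)) =
  (ordinary N (N j).+1)%:R / (depth N Rr (N j).+1)%:R :> R.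
Proof.
rewrite natr1; apply: turn_ratio => // i; first by rewrite !ltnS => /N_leq.
exact: hN.
Qed.

Lemma turn_ratio_before j : (0 < N j)%N ->
  1 - (\sum_(i < j) Rr i)%N%:R / ((N j)%:R + \sum_(i < j) ((Rr i)%:R - 1)) =
  (ordinary N (N j))%:R / (depth N Rr (N j))%:R :> R.
Proof.
move=> Nj; apply: turn_ratio => // i; first exact: hN.
exact: N_leq.
Qed.

(** The inequality is hardest just after a rapid turn, where it is assumed; an ordinary turn adds
    [s] on the left and [D] on the right. *)
Lemma ordinary_after (s D : R) J : s <= D ->
  (forall j, (J <= j)%N ->
     s * (depth N Rr (N j).+1)%:R <= D * (ordinary N (N j).+1)%:R) ->
  forall n, (N J <= n)%N -> s * (depth N Rr n.+1)%:R <= D * (ordinary N n.+1)%:R.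
Proof.
move=> sD hJ; elim=> [|n IHn] Nn.
  by have := hJ J (leqnn J); move: Nn; rewrite leqn0 => /eqP ->.
have [/asboolP[j nE]|nr] := boolP (rapid N n.+1).
  rewrite nE; apply: hJ; rewrite leqNgt; apply/negP => /hN.
  by rewrite -nE ltnNge Nn.
have {}Nn : (N J <= n)%N.
  by rewrite -ltnS ltn_neqAle Nn andbT; apply: contra nr => /eqP <-; exact: rapidN.
rewrite /depth /ordinary big_ord_recr [X in D * X%:R]big_ord_recr /=.
rewrite -/(depth N Rr n.+1) -/(ordinary N n.+1) nr shrink_ordinary//
  !natrD !mulrDr !mulr1.
exact: lerD (IHn Nn) sD.
Qed.

Lemma width_branching m n :
  width (branching N m) n = (m ^ ordinary N n)%N.
Proof.
elim: n => [|n IHn]; first by rewrite /width /ordinary !big_ord0.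
rewrite /width /ordinary !big_ord_recr /= -/(width _ n) -/(ordinary N n) IHn.
by rewrite expnD /branching; case: ifP; rewrite ?expn1.
Qed.

Lemma width_ge (beta D : R) m n : 0 < beta -> beta `^ (- D) <= m%:R ->
  beta `^ (- (D * (ordinary N n)%:R)) <= (width (branching N m) n)%:R.
Proof.
move=> beta0 bm; rewrite width_branching natrX -mulNr powRrM powR_mulrn ?powR_ge0//.
by apply: lerXn2r; rewrite ?nnegrE ?powR_ge0.
Qed.

Lemma powR_turn_radius (beta r s : R) n : 0 < beta -> 0 < r ->
  turn_radius beta N Rr r n `^ s = beta `^ (s * (depth N Rr n)%:R) * r `^ s.
Proof.
move=> beta0 r0; rewrite /rad powRM ?exprn_ge0 ?ltW//; congr (_ * _).
by rewrite -powR_mulrn ?ltW// -powRrM mulrC.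
Qed.

End turn_ratio.

(** * From the growth of the tree to the two dimension bounds *)

Theorem theorem2p1 (R : realType) (X : completeMetricType R)
    (mu : {measure set (borelType X) -> \bar R})
    (delta a b eta Cdec r0 : R) (PP : set (set X))
    (N Rr : nat -> nat) (beta rho : R) (S : set X)
    (hmu : ahlfors_regular mu delta a b r0)
    (hclosed : forall P, PP P -> closed P)
    (hdec : absolutely_decaying mu PP eta Cdec r0)
    (hr0 : 0 < r0)
    (hN0 : forall i, (0 < N i)%N)
    (hR0 : forall i, (0 < Rr i)%N)
    (hN : forall i j, (i < j)%N -> (N i < N j)%N)
    (hbeta : 0 < beta < 1)
    (hbeta_small : beta <
      (Cdec^-1 * (a ^+ 2 / b ^+ 2) * 2 `^ (- 2 * delta - eta - 2)) `^ eta^-1)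
    (hrho : 0 < rho < r0)
    (hS : rapid_absolutely_winning N Rr beta rho PP S) :
  let c1 : R := 2^-1 * (a / b) * (4^-1) `^ delta in
  let c2 : R := Cdec * (b / a) * 2 `^ (eta + 1) in
  let D : R := delta - ln (c1 - c2 * beta `^ eta) / ln beta in
  forall (x : X) (r : R), rho <= r < r0 ->
    (limn_einf (fun n : nat =>
       ((1 - (\sum_(i < n.+1) Rr i)%N%:R /
             ((N n)%:R + 1 + \sum_(i < n.+1) ((Rr i)%:R - 1))) * D)%:E)
     <= hausdorff_dim (S `&` cball x r))%E /\
    (limn_esup (fun n : nat =>
       ((1 - (\sum_(i < n) Rr i)%N%:R /
             ((N n)%:R + \sum_(i < n) ((Rr i)%:R - 1))) * D)%:E)
     <= packing_dim (S `&` cball x r))%E.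
Proof.
move=> c1 c2 D x r hr.
have [/andP[a0 a1] b1 _] := hmu; have [eta0 C0 _] := hdec.
have delta0 := ahlfors_exponent_ge0 hmu hr0.
have [beta0 beta1] := andP hbeta; have [rho0 _] := andP hrho.
have r_gt0 : 0 < r by case/andP: hr => /(lt_le_trans rho0).
have powD : beta `^ (- D) = beta `^ (- delta) * (c1 - c2 * beta `^ eta).
  exact: powR_exponent.
have D_beta : 0 < D -> 4 * beta <= 1 by exact: exponent_gt0.
(* Large enough for the growth of the tree ([mge]), and exceeding [beta ^ (- D)] by at most 1, as
   [separated_children] demands ([mle]). *)
pose m := (Num.trunc (beta `^ (- D))).+1.
have mge : beta `^ (- D) <= m%:R by rewrite ltW// truncnS_gt.
have mle : m%:R <= beta `^ (- delta) * (c1 - c2 * beta `^ eta) + 1.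
  by rewrite -powD /m -natr1 lerD2r truncn_le// powR_ge0.
have widthge n := width_ge N n beta0 mge.
have [sigma sigmaP] := hS.
have kids_ex : 0 < D -> exists kids : gball X -> set X -> seq X,
    forall B P, PP P -> 0 < Defs.radius B < r0 ->
  [/\ size (kids B P) = m,
    forall y, y \in kids B P ->
      cball y (beta * Defs.radius B) `<=`
        gset B `\` nbhood P (beta * Defs.radius B) &
    pairwise (fun y z => 2 * (beta * Defs.radius B) < mdist y z) (kids B P)].
  move=> /D_beta beta4.
  have /choice[g gP] : forall BP : gball X * set X, exists s : seq X,
      PP BP.2 -> 0 < Defs.radius BP.1 < r0 -> [/\ size s = m,
      forall y, y \in s -> cball y (beta * Defs.radius BP.1) `<=`
        gset BP.1 `\` nbhood BP.2 (beta * Defs.radius BP.1) &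
      pairwise (fun y z => 2 * (beta * Defs.radius BP.1) < mdist y z) s].
    move=> [B P] /=; have [[PPP rB]|nh] := pselect (PP P /\ 0 < Defs.radius B < r0).
      have [s sP] := separated_children hmu hr0 (centre B) hdec PPP rB beta0 beta4 mle.
      by exists s.
    by exists [::] => PPP rB; case: nh.
  by exists (fun B P => g (B, P)) => B P; exact: (gP (B, P)).
pose o n : R := (ordinary N n)%:R; pose tau n : R := (depth N Rr n)%:R.
have tau_gt0 n : (0 < n)%N -> 0 < tau n.
  by move=> n0; rewrite ltr0n; apply: leq_trans n0 (depth_ge N hR0 n).
have o_le_tau n : o n <= tau n.
  by rewrite ler_nat; apply: leq_trans (ordinary_le N n) (depth_ge N hR0 n).
(* A positive [s] below one of the bounds forces [0 < D], so the tree is only built when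
   [4 * beta <= 1]. *)
have growth_pos n s : 0 < tau n -> 0 < s -> s * tau n < D * o n -> 0 < D.
  move=> t0 s0 h; have : 0 < D * o n by apply: lt_trans h; rewrite mulr_gt0.
  by rewrite ltNge; apply: contraNT; rewrite -leNgt => ?; rewrite mulr_le0_ge0.
split.
- apply/ereal_infP => _ [s [s0 Hs] <-]; rewrite leNgt; apply/negP => /lt_limn_einf[J hJ].
  have {}hJ j : (J <= j)%N -> s * tau (N j).+1 < D * o (N j).+1.
    move=> /hJ; rewrite lte_fin turn_ratio_after// => h.
    by rewrite -ltr_pdivlMr ?tau_gt0// -mulrA mulrC.
  have D0 : 0 < D by exact: growth_pos (tau_gt0 _ _) s0 (hJ J _).
  have sD : s <= D.
    have /ltW := hJ J (leqnn J); move=> /le_trans /(_ (ler_wpM2l (ltW D0) (o_le_tau _))).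
    by rewrite ler_pM2r// tau_gt0.
  have [kids kidsP] := kids_ex D0.
  apply: (game_hausdorff hmu hr0 hN hR0 beta0 (D_beta D0) rho0 hr (ltn0Sn _)
    sigmaP kidsP s0 _ _ Hs (C := beta `^ D * r `^ s) (n0 := N J)).
    by rewrite mulr_gt0 ?powR_gt0.
  move=> n Jn; rewrite powR_turn_radius// mulrA ler_pM2r ?powR_gt0//.
  apply: le_trans (ler_wpM2r (powR_ge0 _ _) (widthge n)).
  rewrite -powRD ?(gt_eqF beta0) ?implybT//; apply: ger_powR; first by rewrite beta0 ltW.
  have h := ordinary_after hN sD (fun j Jj => ltW (hJ j Jj)) Jn.
  (* Passing from the radius of level [n.+1] to the width of level [n] loses at most one ordinary
     turn, which is the factor [beta ^ D] in the constant. *)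
  have : D * o n.+1 <= D * (o n + 1).
    rewrite ler_pM2l// /o natr1 ler_nat /ordinary big_ord_recr /= -addn1 leq_add2l.
    by case: rapid.
  by rewrite mulrDr mulr1; move: h; rewrite -/(o n.+1) -/(o n); lra.
(* The margin [e] makes width times the [s]-th power of the radius unbounded along the turns
   [N j]. *)
- apply/ereal_infP => _ [s [s0 Hs] <-]; apply/lee_addgt0Pr => e e0.
  rewrite leNgt -EFinD; apply/negP => /lt_limn_esup hJ.
  have {}hJ n0 : exists2 j, (n0 <= j)%N & (s + e) * tau (N j) < D * o (N j).
    have [j nj] := hJ n0; rewrite lte_fin turn_ratio_before// => h.
    by exists j; rewrite // -ltr_pdivlMr ?tau_gt0// -mulrA mulrC.
  have D0 : 0 < D.
    by have [j _ hj] := hJ 0%N; apply: growth_pos (tau_gt0 _ _) _ hj; rewrite ?addr_gt0.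
  have [kids kidsP] := kids_ex D0.
  apply: (game_packing hmu hr0 hN hR0 beta0 (D_beta D0) rho0 hr (ltn0Sn _)
    sigmaP kidsP s0 _ Hs) => Y n0.
  have L0 : 0 < - ln beta by rewrite oppr_gt0 ln_lt0.
  have rs0 : 0 < r `^ s by rewrite powR_gt0.
  (* Since [exp u >= 1 + u], the power [beta ^ (- (e * tau))] exceeds [e * tau * - ln beta], which
     reaches the required value once [tau >= n1]. *)
  pose n1 := (Num.trunc (Y / (r `^ s) / (e * - ln beta))).+1.
  have [j nj hj] := hJ (maxn n0 n1).
  have jN : (j <= N j)%N by exact: leq_N.
  exists (N j); first by apply: leq_trans jN; apply: leq_trans (leq_maxl _ _) nj.
  rewrite powR_turn_radius// mulrA -ler_pdivrMr//.
  apply: le_trans (ler_wpM2r (powR_ge0 _ _) (widthge (N j))).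
  rewrite -powRD ?(gt_eqF beta0) ?implybT//.
  have Yn : Y / (r `^ s) <= n1%:R * (e * - ln beta).
    by rewrite -ler_pdivrMr ?mulr_gt0// ltW// truncnS_gt.
  apply: le_trans Yn _; apply: (@le_trans _ _ (beta `^ (- (e * tau (N j))))); last first.
    by apply: ger_powR; [rewrite beta0 ltW|move: hj; rewrite -/(o _) -/(tau _); lra].
  rewrite /powR gt_eqF//; apply: le_trans (expR_ge1Dx _).
  have : n1%:R * (e * - ln beta) <= tau (N j) * (e * - ln beta).
    rewrite ler_pM2r ?mulr_gt0// ler_nat; apply: leq_trans (depth_ge N hR0 _).
    by apply: leq_trans jN; apply: leq_trans (leq_maxr _ _) nj.
  by rewrite (_ : - _ * _ = tau (N j) * (e * - ln beta)); [lra|ring].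
Qed.
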